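(* Let $\Lambda$ be a standard tableau whose shape $\lambda$ is a partition of a positive integer $l$, let $\mathrm{M}$ be a standard tableau whose shape $\mu$ is a partition of a positive integer $m$, and let $z,w\in\mathbb{C}(q)$ be non-zero with $z^{-1}w\notin q^{2\mathbb{Z}}$. Let $W$ and $W'$ be the $\widehat H_{l+m}$-modules defined in the context, realized as left ideals of $H_{l+m}$. Then the operator $I:W\to W'$ of right multiplication in $H_{l+m}$ by the element $$S_{\Lambda\mathrm{M}}(z,w)=\prod_{i=1,\ldots,l}^{\longrightarrow}\Bigl(\prod_{j=1,\ldots,m}^{\longleftarrow}F_{l+m-i-j+1}\bigl(q^{2c_i(\Lambda)}z,\,q^{2c_j(\mathrm{M})}w\bigr)\Bigr)$$ is an intertwiner of $\widehat H_{l+m}$-modules.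
   Context: Hecke algebras. Let $q$ be a formal parameter. For a positive integer $l$, $H_l$ is the $\mathbb{C}(q)$-algebra with generators $T_1,\ldots,T_{l-1}$ and relations $(T_i-q)(T_i+q^{-1})=0$; $T_iT_{i+1}T_i=T_{i+1}T_iT_{i+1}$; $T_iT_j=T_jT_i$ for $|i-j|\ge2$. The affine Hecke algebra $\widehat H_l$ is the $\mathbb{C}(q)$-algebra generated by $T_1,\ldots,T_{l-1}$ and pairwise commuting invertible elements $Y_1,\ldots,Y_l$ subject to the relations of $H_l$ and $T_iY_iT_i=Y_{i+1}$; $T_iY_j=Y_jT_i$ for $j\ne i,i+1$. For non-zero $z\in\mathbb{C}(q)$ the evaluation homomorphism $\pi_z:\widehat H_l\to H_l$ is identical on $H_l$ with $\pi_z(Y_1)=z$; for an $H_l$-module $V$, $V(z)$ is the pullback of $V$ through $\pi_z$. Tableaux. The Young diagram of $\lambda$ is $\{(a,b)\in\mathbb{Z}^2: 1\le a,\ 1\le b\le\lambda_a\}$. A tableau of shape $\lambda$ is a bijection $\Lambda$ from the diagram to $\{1,\ldots,l\}$; it is standard if $\Lambda(a,b)<\Lambda(a+1,b)$ and $\Lambda(a,b)<\Lambda(a,b+1)$ whenever defined. If $\Lambda(a,b)=i$ put $c_i(\Lambda)=b-a$. Elements $F_\Lambda$. Put $F_i(x,y)=T_i+\dfrac{q-q^{-1}}{x^{-1}y-1}$. For a standard tableau $\Lambda$ let $F_\Lambda(z_1,\ldots,z_l)=\prod^{\longrightarrow}_{(i,j)}F_{j-i}(q^{2c_i(\Lambda)}z_i,q^{2c_j(\Lambda)}z_j)$,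 the product over pairs $1\le i<j\le l$ ordered from left to right so that $(i,j)$ precedes $(i',j')$ if $j<j'$, or $j=j'$ and $i<i'$. Let $\mathcal{Z}_\Lambda\subset\mathbb{C}(q)^{\times l}$ be the subspace of tuples with $z_i=z_j$ whenever $i,j$ are in the same column of $\Lambda$. The restriction of $F_\Lambda(z_1,\ldots,z_l)$ to $\mathcal{Z}_\Lambda$ is regular at $(1,\ldots,1)$; its value there is $F_\Lambda\in H_l$. Put $V_\Lambda=H_lF_\Lambda$, with $H_l$ acting by left multiplication. Modules. $\widehat H_l\otimes\widehat H_m$ is identified with the subalgebra of $\widehat H_{l+m}$ generated by $T_1,\ldots,T_{l-1},Y_1,\ldots,Y_l$ and $T_{l+1},\ldots,T_{l+m-1},Y_{l+1},\ldots,Y_{l+m}$. $W$ is the $\widehat H_{l+m}$-module induced from the $\widehat H_l\otimes\widehat H_m$-module $V_\Lambda(z)\otimes V_{\mathrm{M}}(w)$, realized as the left ideal of $H_{l+m}$ generated by $F_\Lambda\overline{F}_{\mathrm{M}}$, where $\overline{F}_{\mathrm{M}}$ is the image of $F_{\mathrm{M}}\in H_m$ under $H_m\to H_{l+m}$, $T_j\mapsto T_{l+j}$. Here $H_{l+m}$ acts by left multiplication and the action of the $Y$'s is determined by $Y_i\cdot F_\Lambda\overline{F}_{\mathrm{M}}=zq^{2c_i(\Lambda)}F_\Lambda\overline{F}_{\mathrm{M}}$ ($1\le i\le l$), $Y_{l+j}\cdot F_\Lambda\overline{F}_{\mathrm{M}}=wq^{2c_j(\mathrm{M})}F_\Lambda\overline{F}_{\mathrm{M}}$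 ($1\le j\le m$). $W'$ is the $\widehat H_{l+m}$-module induced from the $\widehat H_m\otimes\widehat H_l$-module $V_{\mathrm{M}}(w)\otimes V_\Lambda(z)$, realized as the left ideal of $H_{l+m}$ generated by $F_{\mathrm{M}}\overline{F}_\Lambda$, where $\overline{F}_\Lambda$ is the image of $F_\Lambda\in H_l$ under $H_l\to H_{l+m}$, $T_i\mapsto T_{i+m}$; $H_{l+m}$ acts by left multiplication and $Y_{i+m}\cdot F_{\mathrm{M}}\overline{F}_\Lambda=zq^{2c_i(\Lambda)}F_{\mathrm{M}}\overline{F}_\Lambda$ ($1\le i\le l$), $Y_j\cdot F_{\mathrm{M}}\overline{F}_\Lambda=wq^{2c_j(\mathrm{M})}F_{\mathrm{M}}\overline{F}_\Lambda$ ($1\le j\le m$). In ordered products, $\longrightarrow$ (resp. $\longleftarrow$) means the index increases (resp. decreases) from left to right. One has $F_\Lambda\overline{F}_{\mathrm{M}}\,S_{\Lambda\mathrm{M}}(z,w)=S'_{\Lambda\mathrm{M}}(z,w)\,F_{\mathrm{M}}\overline{F}_\Lambda$ with $S'_{\Lambda\mathrm{M}}(z,w)=\prod_{i=1,\ldots,l}^{\longleftarrow}\bigl(\prod_{j=1,\ldots,m}^{\longrightarrow}F_{i+j-1}(q^{2c_i(\Lambda)}z,q^{2c_j(\mathrm{M})}w)\bigr)$, so that right multiplication by $S_{\Lambda\mathrm{M}}(z,w)$ does map $W$ to $W'$. *)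

(* Defs.v *)
From HB Require Import structures.
From mathcomp Require Import all_boot all_order all_algebra.
From mathcomp Require Import generic_quotient complex.
From mathcomp Require Import boolp classical_sets functions reals.
From mathcomp Require Import zify.
From mathcomp Require monalg mpoly.
Import -(notations) monalg.

Set Implicit Arguments.
Unset Strict Implicit.
Unset Printing Implicit Defensive.

Import Order.TTheory GRing.Theory Num.Theory.
Local Open Scope ring_scope.
Local Open Scope quotient_scope.
Local Open Scope classical_set_scope.

Section FreeAlgebra.
Variables (K : fieldType) (G : choiceType).

(* Noncommutative polynomials: the monoid algebra of the free monoid on [G]. *)
Definition freeAlg := malg (fmonom G) K.
HB.instance Definition _ := GRing.Lalgebra.on freeAlg.

Definition freeGen (g : G) : freeAlg := mkmalgU (fmu g) 1.

Lemma freeAlg_scalerAr c (x y : freeAlg) : c *: (x * y) = x * (c *: y).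
Proof.
have h (g : malg (fmonom G) K) : g * mkmalgU mone c = c *: g.
  rewrite malgM_def malgZ_def fgmulgU.
  by apply: eq_bigr => k _; rewrite mulm1 mulrC.
by rewrite -[LHS](h (x * y)) -[c *: y](h y) mulrA.
Qed.

Section Eval.
Variables (A : algType K) (f : G -> A).

Definition wordEval (m : fmonom G) : A := \prod_(g <- fmonom_val m) f g.

Fact wordEval_mmorphism : mmorphism wordEval.
Proof.
split=> [x y|]; rewrite /wordEval /mone /mmul /=.
  by rewrite fmmulE big_cat.
by rewrite fmoneE big_nil.
Qed.

HB.instance Definition _ :=
  isMultiplicative.Build (fmonom G) A wordEval wordEval_mmorphism.

Definition freeEval : freeAlg -> A := mmap (in_alg A) wordEval.

Fact freeEval_zmod : zmod_morphism freeEval.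
Proof. exact: mmap_is_additive. Qed.
HB.instance Definition _ :=
  GRing.isZmodMorphism.Build freeAlg A freeEval freeEval_zmod.

Fact freeEval_monoid : monoid_morphism freeEval.
Proof.
have [|hM h1] := @commr_mmap_is_multiplicative
    (fmonom G) K A (in_alg A) wordEval; last by split.
by move=> g m m'; rewrite /GRing.comm /= -scalerAl mul1r -scalerAr mulr1.
Qed.
HB.instance Definition _ :=
  GRing.isMonoidMorphism.Build freeAlg A freeEval freeEval_monoid.

Fact freeEval_scalable : scalable freeEval.
Proof.
move=> c x; rewrite /freeEval;
by rewrite [LHS](@mmapZ (fmonom G) K A (in_alg A) wordEval) /= -scalerAl mul1r.
Qed.
HB.instance Definition _ :=
  GRing.isScalable.Build K freeAlg A *:%R freeEval freeEval_scalable.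

Lemma freeEvalG g : freeEval (freeGen g) = f g.
Proof.
rewrite /freeEval /freeGen (mmapU (f := in_alg A)) /= scale1r mul1r.
by rewrite /wordEval fmuE /= big_seq1.
Qed.

End Eval.
End FreeAlgebra.

Section PresentedAlgebra.
Variables (K : fieldType) (G : choiceType).
Variable rel : freeAlg K G -> freeAlg K G -> Prop.

Definition twoSidedIdeal (I : set (freeAlg K G)) : Prop :=
  [/\ I 0, forall x y, I x -> I y -> I (x + y) &
      forall a x b, I x -> I (a * x * b)].

Definition relIdeal : set (freeAlg K G) :=
  [set x | forall I, twoSidedIdeal I ->
     (forall a b, rel a b -> I (a - b)) -> I x].

Lemma relIdealP : twoSidedIdeal relIdeal.
Proof.
split=> [I [] //|x y hx hy I hI hr|a x b hx I hI hr].
  by case: (hI) => _ h _; apply: h; [apply: hx|apply: hy].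
by case: (hI) => _ _ h; apply: h; apply: hx.
Qed.

Lemma relIdeal_rel a b : rel a b -> relIdeal (a - b).
Proof. by move=> hab I _; apply. Qed.

Lemma relIdeal0 : relIdeal 0. Proof. by case: relIdealP. Qed.
Lemma relIdealD x y : relIdeal x -> relIdeal y -> relIdeal (x + y).
Proof. by case: relIdealP => _ h _; apply: h. Qed.
Lemma relIdealMl a x : relIdeal x -> relIdeal (a * x).
Proof. by case: relIdealP => _ _ h /(h a x 1); rewrite mulr1. Qed.
Lemma relIdealMr x b : relIdeal x -> relIdeal (x * b).
Proof. by case: relIdealP => _ _ h /(h 1 x b); rewrite mul1r. Qed.
Lemma relIdealN x : relIdeal x -> relIdeal (- x).
Proof. by rewrite -mulN1r; apply: relIdealMl. Qed.
Lemma relIdealZ c x : relIdeal x -> relIdeal (c *: x).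
Proof. by rewrite -[x in c *: x]mul1r scalerAl; apply: relIdealMl. Qed.

Definition presEq (x y : freeAlg K G) : bool := `[< relIdeal (x - y) >].

Fact presEq_refl : reflexive presEq.
Proof. by move=> x; apply/asboolP; rewrite subrr; apply: relIdeal0. Qed.
Fact presEq_sym : symmetric presEq.
Proof.
by move=> x y; apply/asboolP/asboolP=> /relIdealN; rewrite opprB.
Qed.
Fact presEq_trans : transitive presEq.
Proof.
move=> y x z /asboolP h1 /asboolP h2; apply/asboolP.
by rewrite -(subrKA y); apply: relIdealD.
Qed.
Canonical presEq_equiv := EquivRel presEq presEq_refl presEq_sym presEq_trans.

Definition presAlg := {eq_quot presEq}.
HB.instance Definition _ := Choice.on presAlg.
HB.instance Definition _ := EqQuotient.on presAlg.

End PresentedAlgebra.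

(* The operations are locked, lest failing unification problems unfold them
   down to the monoid algebra. *)
HB.lock Definition presPi (K : fieldType) (G : choiceType)
  (rel : freeAlg K G -> freeAlg K G -> Prop) (x : freeAlg K G) : presAlg rel :=
  \pi_(presAlg rel) x.
HB.lock Definition presAdd (K : fieldType) (G : choiceType)
  (rel : freeAlg K G -> freeAlg K G -> Prop) (x y : presAlg rel) : presAlg rel :=
  presPi rel (repr x + repr y).
HB.lock Definition presOpp (K : fieldType) (G : choiceType)
  (rel : freeAlg K G -> freeAlg K G -> Prop) (x : presAlg rel) : presAlg rel :=
  presPi rel (- repr x).
HB.lock Definition presMul (K : fieldType) (G : choiceType)
  (rel : freeAlg K G -> freeAlg K G -> Prop) (x y : presAlg rel) : presAlg rel :=
  presPi rel (repr x * repr y).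
HB.lock Definition presScale (K : fieldType) (G : choiceType)
  (rel : freeAlg K G -> freeAlg K G -> Prop) (c : K) (x : presAlg rel)
  : presAlg rel := presPi rel (c *: repr x).

Section PresentedAlgebraTheory.
Variables (K : fieldType) (G : choiceType).
Variable rel : freeAlg K G -> freeAlg K G -> Prop.
Notation presAlg := (presAlg rel).
Notation presPi := (presPi rel).
Notation presAdd := (@presAdd K G rel).
Notation presOpp := (@presOpp K G rel).
Notation presMul := (@presMul K G rel).
Notation presScale := (@presScale K G rel).
Notation relIdeal := (relIdeal rel).

Definition presGen (g : G) : presAlg := presPi (freeGen K g).

Lemma presPiP x y : presPi x = presPi y <-> relIdeal (x - y).
Proof.
rewrite presPi.unlock; split=> [/eqmodP/asboolP //|h].
by apply/eqmodP/asboolP.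
Qed.

Lemma presPi_surj (x : presAlg) : exists y, x = presPi y.
Proof. by exists (repr x); rewrite presPi.unlock reprK. Qed.

Lemma presPi_repr x : relIdeal (repr (presPi x) - x).
Proof. by apply/presPiP; rewrite presPi.unlock reprK. Qed.

Lemma presAddE x y : presAdd (presPi x) (presPi y) = presPi (x + y).
Proof.
rewrite presAdd.unlock; apply/presPiP; rewrite opprD addrACA.
by apply: relIdealD; apply: presPi_repr.
Qed.
Lemma presOppE x : presOpp (presPi x) = presPi (- x).
Proof. by rewrite presOpp.unlock; apply/presPiP; rewrite -opprD; apply: relIdealN; apply: presPi_repr. Qed.
Lemma presMulE x y : presMul (presPi x) (presPi y) = presPi (x * y).
Proof.
rewrite presMul.unlock; apply/presPiP; set x' := repr _; set y' := repr _.
have -> : x' * y' - x * y = x' * (y' - y) + (x' - x) * y.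
  by rewrite mulrBr mulrBl subrKA.
apply: relIdealD; first by apply: relIdealMl; apply: presPi_repr.
by apply: relIdealMr; apply: presPi_repr.
Qed.
Lemma presScaleE c x : presScale c (presPi x) = presPi (c *: x).
Proof. by rewrite presScale.unlock; apply/presPiP; rewrite -scalerBr; apply: relIdealZ; apply: presPi_repr. Qed.

Ltac pres_tac :=
  repeat (let x := fresh "x" in move=> x; try have [? ->] := presPi_surj x);
  rewrite ?(presAddE, presOppE, presMulE, presScaleE); congr presPi.

Fact presAddA : associative presAdd.
Proof. by pres_tac; rewrite addrA. Qed.
Fact presAddC : commutative presAdd.
Proof. by pres_tac; rewrite addrC. Qed.
Fact presAdd0 : left_id (presPi 0) presAdd.
Proof. by pres_tac; rewrite add0r. Qed.
Fact presAddN : left_inverse (presPi 0) presOpp presAdd.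
Proof. by pres_tac; rewrite addNr. Qed.
Fact presMulA : associative presMul.
Proof. by pres_tac; rewrite mulrA. Qed.
Fact presMul1r : left_id (presPi 1) presMul.
Proof. by pres_tac; rewrite mul1r. Qed.
Fact presMulr1 : right_id (presPi 1) presMul.
Proof. by pres_tac; rewrite mulr1. Qed.
Fact presMulDl : left_distributive presMul presAdd.
Proof. by pres_tac; rewrite mulrDl. Qed.
Fact presMulDr : right_distributive presMul presAdd.
Proof. by pres_tac; rewrite mulrDr. Qed.

HB.instance Definition _ := GRing.isPzRing.Build presAlg
  presAddA presAddC presAdd0 presAddN
  presMulA presMul1r presMulr1 presMulDl presMulDr.

Fact presScaleA a b v : presScale a (presScale b v) = presScale (a * b) v.
Proof. by move: v; pres_tac; rewrite scalerA. Qed.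
Fact presScale1 : left_id 1 presScale.
Proof. by pres_tac; rewrite scale1r. Qed.
Fact presScaleDr : right_distributive presScale +%R.
Proof.
move=> a x y; have [u ->] := presPi_surj x; have [v ->] := presPi_surj y.
by rewrite /GRing.add /= !(presAddE, presScaleE) scalerDr.
Qed.
Fact presScaleDl v : {morph presScale^~ v : a b / a + b}.
Proof.
move=> a b; have [u ->] := presPi_surj v.
by rewrite [in RHS]/GRing.add /= !(presAddE, presScaleE) scalerDl.
Qed.
HB.instance Definition _ := GRing.Zmodule_isLmodule.Build K presAlg
  presScaleA presScale1 presScaleDr presScaleDl.

Lemma presPi0 : presPi 0 = 0. Proof. by []. Qed.
Lemma presPi1 : presPi 1 = 1. Proof. by []. Qed.
Lemma presPiD x y : presPi (x + y) = presPi x + presPi y.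
Proof. by rewrite -presAddE. Qed.
Lemma presPiN x : presPi (- x) = - presPi x.
Proof. by rewrite -presOppE. Qed.
Lemma presPiM x y : presPi (x * y) = presPi x * presPi y.
Proof. by rewrite -presMulE. Qed.
Lemma presPiZ c x : presPi (c *: x) = c *: presPi x.
Proof. by rewrite -presScaleE. Qed.

Lemma presPi_rel x y : rel x y -> presPi x = presPi y.
Proof. by move=> h; apply/presPiP; apply: relIdeal_rel. Qed.
Lemma presPiM3 x y z : presPi (x * y * z) = presPi x * presPi y * presPi z.
Proof. by rewrite (presPiM (x * y)) (presPiM x). Qed.
Lemma presPi_quad x a b :
  presPi ((x - a *: 1) * (x + b *: 1)) =
  (presPi x - a *: (1 : presAlg)) * (presPi x + b *: (1 : presAlg)).
Proof.
rewrite (presPiM (x - a *: 1)) (presPiD x (- (a *: 1))) (presPiN (a *: 1)).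
by rewrite (presPiD x (b *: 1)) (presPiZ a 1) (presPiZ b 1).
Qed.

Lemma pres_scalerAl c (x y : presAlg) : c *: (x * y) = (c *: x) * y.
Proof.
have [u ->] := presPi_surj x; have [v ->] := presPi_surj y.
by rewrite -(presPiZ c u) -(presPiM u v) -presPiM -presPiZ scalerAl.
Qed.

Lemma pres_scalerAr c (x y : presAlg) : c *: (x * y) = x * (c *: y).
Proof.
have [u ->] := presPi_surj x; have [v ->] := presPi_surj y.
by rewrite -(presPiZ c v) -(presPiM u v) -presPiM -presPiZ freeAlg_scalerAr.
Qed.

Section Lift.
Variables (A : algType K) (f : G -> A).
Hypothesis frel : forall a b, rel a b -> freeEval f a = freeEval f b.

Lemma freeEval_ideal x : relIdeal x -> freeEval f x = 0.
Proof.
move=> hx; apply: (hx [set y | freeEval f y = 0]) => [|a b /frel h];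
  last by rewrite /= raddfB /= h subrr.
split=> [|x' y /= hx' hy|a x' b /= hx'] /=; first by rewrite raddf0.
- by rewrite raddfD /= hx' hy addr0.
- by rewrite !rmorphM /= hx' mulr0 mul0r.
Qed.

Definition presLift (x : presAlg) : A := freeEval f (repr x).

Lemma presLiftPi x : presLift (presPi x) = freeEval f x.
Proof.
apply/eqP; rewrite -subr_eq0; apply/eqP.
rewrite /presLift -(raddfB (freeEval f)).
by apply: freeEval_ideal; apply: presPi_repr.
Qed.

Lemma presLiftG g : presLift (presGen g) = f g.
Proof. by rewrite presLiftPi freeEvalG. Qed.

Fact presLift_zmod : zmod_morphism presLift.
Proof.
move=> x y; have [u ->] := presPi_surj x; have [v ->] := presPi_surj y.
by rewrite -(presPiN v) -(presPiD u) !presLiftPi raddfB.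
Qed.
Fact presLift_monoid : monoid_morphism presLift.
Proof.
split=> [|x y]; first by rewrite presLiftPi rmorph1.
have [u ->] := presPi_surj x; have [v ->] := presPi_surj y.
by rewrite -(presPiM u v) !presLiftPi rmorphM.
Qed.
Fact presLift_scalable : scalable presLift.
Proof.
move=> c x; have [u ->] := presPi_surj x.
by rewrite -(presPiZ c u) !presLiftPi linearZ.
Qed.

End Lift.
End PresentedAlgebraTheory.

(* Generators are indexed from 1; [genAt f i] is 0 when i is out of range. *)
Definition genIdx (n : nat) : choiceType := {i : nat | (0 < i < n)%N}.

Definition genAt (V : nmodType) (n : nat) (f : genIdx n -> V) (i : nat) : V :=
  oapp f 0 (insub i).

Section Relations.
Variables (K : fieldType) (A : lalgType K) (q : K) (n : nat).
Variables T Y Yinv : nat -> A.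

Variant heckeRel : A -> A -> Prop :=
| HeckeQuad i of (0 < i < n)%N :
    heckeRel ((T i - q%:A) * (T i + q^-1%:A)) 0
| HeckeBraid i of (0 < i)%N & (i.+1 < n)%N :
    heckeRel (T i * T i.+1 * T i) (T i.+1 * T i * T i.+1)
| HeckeComm i j of (0 < i < n)%N & (0 < j < n)%N
    & (i.+2 <= j)%N || (j.+2 <= i)%N :
    heckeRel (T i * T j) (T j * T i).

Variant affHeckeRel : A -> A -> Prop :=
| AffHecke a b of heckeRel a b : affHeckeRel a b
| AffYY i j of (0 < i <= n)%N & (0 < j <= n)%N :
    affHeckeRel (Y i * Y j) (Y j * Y i)
| AffYV i of (0 < i <= n)%N : affHeckeRel (Y i * Yinv i) 1
| AffVY i of (0 < i <= n)%N : affHeckeRel (Yinv i * Y i) 1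
| AffTYT i of (0 < i < n)%N : affHeckeRel (T i * Y i * T i) (Y i.+1)
| AffTY i j of (0 < i < n)%N & (0 < j <= n)%N & j != i & j != i.+1 :
    affHeckeRel (T i * Y j) (Y j * T i).

End Relations.

Lemma genAtE (V : nmodType) n (f : genIdx n -> V) i (h : (0 < i < n)%N) :
  genAt f i = f (exist _ i h).
Proof. by rewrite /genAt insubT. Qed.

Lemma heckeRel_map (K : fieldType) (A B : lalgType K) (phi : {lrmorphism A -> B})
    q n (T : nat -> A) (T' : nat -> B) a b :
  (forall i, (0 < i < n)%N -> phi (T i) = T' i) ->
  heckeRel q n T a b -> heckeRel q n T' (phi a) (phi b).
Proof.
move=> hT [i hi|i i0 hi|i j hi hj hij].
- rewrite rmorphM rmorphB rmorphD /= !linearZ /= rmorph1 rmorph0 hT // scalerN.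
  exact: HeckeQuad.
- rewrite !rmorphM /= !hT ?hi ?i0 ?(ltnW hi) //; exact: HeckeBraid.
- by rewrite !rmorphM /= !hT //; apply: HeckeComm.
Qed.

Lemma heckeRel_shift (K : fieldType) (A : lalgType K) q k n s (T : nat -> A) a b :
  (s + k <= n)%N ->
  heckeRel q k (fun i => T (s + i)%N) a b -> heckeRel q n T a b.
Proof.
move=> h; case=> [i hi|i i0 hi|i j hi hj hij].
- apply: HeckeQuad; lia.
- rewrite addnS; apply: HeckeBraid; lia.
- apply: HeckeComm; lia.
Qed.

Section HeckeAlgebras.
Variables (K : fieldType) (q : K).

Section Finite.
Variable n : nat.

Definition hecke := presAlg (heckeRel q n (genAt (@freeGen K (genIdx n)))).
HB.instance Definition _ := GRing.PzRing.on hecke.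
HB.instance Definition _ := GRing.Lmodule.on hecke.

Fact hecke_neq0 : 1 != 0 :> hecke.
Proof.
pose f (_ : genIdx n) : K^o := q.
apply/eqP => /(presPiP _ _ _).1; rewrite subr0 => h.
suff /eqP : freeEval f 1 = 0 by rewrite rmorph1 oner_eq0.
apply: freeEval_ideal h => a b.
have fT i : (0 < i < n)%N -> freeEval f (genAt (@freeGen K _) i) = q.
  by move=> hi; rewrite genAtE freeEvalG.
move/(heckeRel_map fT); case=> [i _|//|//].
by rewrite [q%:A]mulr1 subrr mul0r.
Qed.
HB.instance Definition _ := GRing.PzSemiRing_isNonZero.Build hecke hecke_neq0.
HB.instance Definition _ := GRing.Lmodule_isLalgebra.Build K hecke
  (@pres_scalerAl _ _ _).
HB.instance Definition _ := GRing.Lalgebra_isAlgebra.Build K hecke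
  (@pres_scalerAr _ _ _).

Definition heckeT (i : nat) : hecke := genAt (presGen _) i.

Lemma heckeT_map (i : nat) : (0 < i < n)%N ->
  heckeT i = presPi _ (genAt (@freeGen K _) i).
Proof. by move=> hi; rewrite /heckeT !genAtE. Qed.

Lemma heckeP a b : heckeRel q n heckeT a b -> a = b.
Proof.
case=> [i hi|i i0 hi|i j hi hj hij].
- rewrite (heckeT_map hi); apply: etrans (esym (presPi_quad _ _ _ _)) _.
  by apply: presPi_rel; exact: HeckeQuad.
- have hi0 : (0 < i < n)%N by rewrite i0 ltnW.
  rewrite (heckeT_map hi0) (heckeT_map (hi : 0 < i.+1 < n)%N).
  apply: etrans (esym (presPiM3 _ _ _ _)) _.
  apply: etrans _ (presPiM3 _ _ _ _).
  by apply: presPi_rel; exact: HeckeBraid.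
- rewrite (heckeT_map hi) (heckeT_map hj).
  apply: etrans (esym (presPiM _ _ _)) _.
  apply: etrans _ (presPiM _ _ _).
  by apply: presPi_rel; exact: HeckeComm.
Qed.

(* Generators, in this order: the T_i, the Y_j and the inverses of the Y_j.
   For q = 0 the presented algebra is trivial as soon as n > 1, hence the
   hypothesis that makes it an [algType]. *)
Definition affIdx : choiceType := (genIdx n + (genIdx n.+1 + genIdx n.+1))%type.

Definition affFreeT := genAt (fun g => @freeGen K affIdx (inl g)).
Definition affFreeY := genAt (fun g => @freeGen K affIdx (inr (inl g))).
Definition affFreeV := genAt (fun g => @freeGen K affIdx (inr (inr g))).

Definition affHeckePres := affHeckeRel q n affFreeT affFreeY affFreeV.
Definition affHecke of q != 0 := presAlg affHeckePres.

Section Affine.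
Hypothesis q0 : q != 0.
Notation affHecke := (affHecke q0).
HB.instance Definition _ := GRing.PzRing.on affHecke.
HB.instance Definition _ := GRing.Lmodule.on affHecke.

Fact affHecke_neq0 : 1 != 0 :> affHecke.
Proof.
pose f (g : affIdx) : K^o := match g with
  | inl _ => q
  | inr (inl j) => q ^+ (val j).*2
  | inr (inr j) => (q ^+ (val j).*2)^-1 end.
apply/eqP => /(presPiP _ _ _).1; rewrite subr0 => h.
suff /eqP : freeEval f 1 = 0 by rewrite rmorph1 oner_eq0.
apply: freeEval_ideal h => a b.
have fT i : (0 < i < n)%N -> freeEval f (affFreeT i) = q.
  by move=> hi; rewrite /affFreeT genAtE freeEvalG.
have fY i : (0 < i <= n)%N -> freeEval f (affFreeY i) = q ^+ i.*2.
  by move=> hi; rewrite /affFreeY genAtE freeEvalG.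
have fV i : (0 < i <= n)%N -> freeEval f (affFreeV i) = (q ^+ i.*2)^-1.
  by move=> hi; rewrite /affFreeV genAtE freeEvalG.
have fM x y : freeEval f (x * y) = freeEval f x * freeEval f y := rmorphM _ x y.
have fC x y : freeEval f (x * y) = freeEval f (y * x).
  by apply: etrans (fM x y) _; apply: etrans (mulrC _ _) (esym (fM y x)).
case=> [{}a {}b|i j hi hj|i hi|i hi|i hi|i j hi hj _ _].
- move/(heckeRel_map fT); case=> [i _|//|//].
  by rewrite [q%:A]mulr1 subrr mul0r.
- exact: fC.
- apply: etrans (fM _ _) _; rewrite rmorph1 fY // fV //.
  by rewrite mulfV // expf_neq0.
- apply: etrans (fM _ _) _; rewrite rmorph1 fY // fV //.
  by rewrite mulVf // expf_neq0.
- have /andP[i0 hin] := hi.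
  rewrite fY //; apply: etrans (fM _ _) _; rewrite fT //.
  rewrite (fM (affFreeT i) (affFreeY i)) fT // fY ?i0 ?(ltnW hin) //.
  by rewrite doubleS exprSr exprS.
- exact: fC.
Qed.
HB.instance Definition _ := GRing.PzSemiRing_isNonZero.Build affHecke affHecke_neq0.
HB.instance Definition _ := GRing.Lmodule_isLalgebra.Build K affHecke
  (@pres_scalerAl _ _ _).
HB.instance Definition _ := GRing.Lalgebra_isAlgebra.Build K affHecke
  (@pres_scalerAr _ _ _).

Definition affT : nat -> affHecke := genAt (fun g => presGen affHeckePres (inl g)).
Definition affY : nat -> affHecke := genAt (fun g => presGen affHeckePres (inr (inl g))).

Lemma affT_map (i : nat) : (0 < i < n)%N -> affT i = presPi affHeckePres (affFreeT i).
Proof. by move=> hi; rewrite /affT /affFreeT !genAtE. Qed.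

Lemma affHecke_heckeP a b : heckeRel q n affT a b -> a = b.
Proof.
case=> [i hi|i i0 hi|i j hi hj hij].
- rewrite (affT_map hi); apply: etrans (esym (presPi_quad _ _ _ _)) _.
  by apply: presPi_rel; apply: AffHecke; exact: HeckeQuad.
- have hi0 : (0 < i < n)%N by rewrite i0 ltnW.
  rewrite (affT_map hi0) (affT_map (hi : 0 < i.+1 < n)%N).
  apply: etrans (esym (presPiM3 _ _ _ _)) _.
  apply: etrans _ (presPiM3 _ _ _ _).
  by apply: presPi_rel; apply: AffHecke; exact: HeckeBraid.
- rewrite (affT_map hi) (affT_map hj).
  apply: etrans (esym (presPiM _ _ _)) _.
  apply: etrans _ (presPiM _ _ _).
  by apply: presPi_rel; apply: AffHecke; exact: HeckeComm.
Qed.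

Definition affIncl : hecke -> affHecke := presLift (fun g => affT (val g)).

Fact affIncl_rel (a b : freeAlg K (genIdx n)) :
  heckeRel q n (genAt (@freeGen K _)) a b ->
  freeEval (fun g : genIdx n => affT (val g)) a = freeEval (fun g => affT (val g)) b.
Proof.
move=> h; apply: affHecke_heckeP; apply: heckeRel_map h => i hi.
by rewrite genAtE; exact: freeEvalG.
Qed.

HB.instance Definition _ := GRing.isZmodMorphism.Build hecke affHecke affIncl
  (presLift_zmod affIncl_rel).
HB.instance Definition _ := GRing.isMonoidMorphism.Build hecke affHecke affIncl
  (presLift_monoid affIncl_rel).
HB.instance Definition _ := GRing.isScalable.Build K hecke affHecke *:%R affIncl
  (presLift_scalable affIncl_rel).

Lemma affInclT i : (0 < i < n)%N -> affIncl (heckeT i) = affT i.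
Proof. by move=> hi; rewrite /heckeT genAtE [LHS](presLiftG affIncl_rel). Qed.

End Affine.
End Finite.

Section Shift.
Variables (k n s : nat) (skn : (s + k <= n)%N).

(* T_i |-> T_(s + i) *)
Definition heckeShift of (s + k <= n)%N : hecke k -> hecke n :=
  presLift (fun g => heckeT n (s + val g)).

Fact heckeShift_rel (a b : freeAlg K (genIdx k)) :
  heckeRel q k (genAt (@freeGen K _)) a b ->
  freeEval (fun g : genIdx k => heckeT n (s + val g)) a =
  freeEval (fun g => heckeT n (s + val g)) b.
Proof.
move=> h; apply: heckeP; apply: (heckeRel_shift skn).
by apply: heckeRel_map h => i hi; rewrite genAtE; exact: freeEvalG.
Qed.

HB.instance Definition _ := GRing.isZmodMorphism.Build (hecke k) (hecke n)
  (heckeShift skn) (presLift_zmod heckeShift_rel).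
HB.instance Definition _ := GRing.isMonoidMorphism.Build (hecke k) (hecke n)
  (heckeShift skn) (presLift_monoid heckeShift_rel).
HB.instance Definition _ := GRing.isScalable.Build K (hecke k) (hecke n) *:%R
  (heckeShift skn) (presLift_scalable heckeShift_rel).

Lemma heckeShiftT i : (0 < i < k)%N ->
  heckeShift skn (heckeT k i) = heckeT n (s + i).
Proof.
by move=> hi; rewrite {1}/heckeT genAtE [LHS](presLiftG heckeShift_rel).
Qed.

End Shift.

Definition heckeF (n i : nat) (x y : K) : hecke n :=
  heckeT n i + ((q - q^-1) / (x^-1 * y - 1))%:A.

End HeckeAlgebras.

Definition isPartition (la : seq nat) (l : nat) : bool :=
  [&& sorted geq la, 0%N \notin la & sumn la == l].

(* Cells are pairs (a, b) = (row, column), counted from 1. *)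
Definition young (la : seq nat) : set (nat * nat) :=
  [set ab | (0 < ab.1)%N && (0 < ab.2 <= nth 0%N la ab.1.-1)%N].

Record stdTableau (la : seq nat) (l : nat) := StdTableau {
  entry :> nat * nat -> nat;
  entry_bij : set_bij (young la) [set i | (0 < i <= l)%N] entry;
  entry_col : forall a b, young la (a, b) -> young la (a.+1, b) ->
    (entry (a, b) < entry (a.+1, b))%N;
  entry_row : forall a b, young la (a, b) -> young la (a, b.+1) ->
    (entry (a, b) < entry (a, b.+1))%N
}.

Definition cellOf la l (L : stdTableau la l) (i : nat) : nat * nat :=
  xget (0%N, 0%N) [set ab | young la ab /\ L ab = i].

Definition content la l (L : stdTableau la l) (i : nat) : int :=
  (cellOf L i).2%:Z - (cellOf L i).1%:Z.

(* [f], an [A]-valued function whose domain of definition is [D], is given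
   near [p] by a fraction whose denominator does not vanish at [p], and the
   value of that fraction at [p] is [v].  When [D] is Zariski dense in an
   affine subspace containing [p], there is at most one such [v]. *)
Definition regularValue (K : fieldType) (A : lmodType K) (n : nat)
    (D : set ('I_n -> K)) (f : ('I_n -> K) -> A) (p : 'I_n -> K) (v : A) : Prop :=
  exists (d : mpoly.mpoly n K) (s : seq (mpoly.mpoly n K * A)),
    let num z := \sum_(t <- s) mpoly.meval z t.1 *: t.2 in
    [/\ mpoly.meval p d != 0,
        forall z, D z -> mpoly.meval z d *: f z = num z &
        v = (mpoly.meval p d)^-1 *: num p].

Section Fusion.
Variables (K : fieldType) (q : K).
Variables (la : seq nat) (l : nat) (L : stdTableau la l).

(* The index [i : 'I_l] of a variable stands for the entry [i.+1]. *)
Definition tabArg (z : 'I_l -> K) (i : 'I_l) : K :=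
  q ^ (2 * content L i.+1) * z i.

Definition tabF (z : 'I_l -> K) : hecke q l :=
  \prod_(j < l) \prod_(i < l | (i < j)%N)
    heckeF q l (j - i) (tabArg z i) (tabArg z j).

Definition tabFdom : set ('I_l -> K) :=
  [set z | forall i j : 'I_l, (i < j)%N ->
     tabArg z i != 0 /\ (tabArg z i)^-1 * tabArg z j != 1].

Definition colSpace : set ('I_l -> K) :=
  [set z | forall i j : 'I_l,
     (cellOf L i.+1).2 = (cellOf L j.+1).2 -> z i = z j].

(* Fusion procedure: [tabF] restricted to [colSpace] is regular at (1,..,1) and
   this is its value there.  It has poles along z_i = z_j for distinct i, j on
   the same diagonal, so it cannot be evaluated directly. *)
Definition fusionF : hecke q l :=
  xget 0 [set v | regularValue (colSpace `&` tabFdom) tabF (fun=> 1) v].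

End Fusion.

(* [W] is the left ideal of the finite Hecke algebra generated by [v], up to
   the identification [iota], the finite Hecke algebra acting by left
   multiplication and each Y_i by the scalar [y i] on [v].  As [v] generates
   the left ideal, the relation T_i Y_i T_i = Y_(i+1) makes such an action
   unique. *)
Record realizedBy (K : fieldType) (q : K) (q0 : q != 0) (n : nat)
    (W : lmodType (affHecke n q0)) (v : hecke q n) (y : nat -> K)
    (iota : W -> hecke q n) : Prop := {
  real_inj : injective iota;
  real_add : {morph iota : u u' / u + u'};
  real_range : range iota = [set x | exists h, x = h * v];
  real_T : forall h u, iota (affIncl q0 h *: u) = h * iota u;
  real_Y : forall i u, (0 < i <= n)%N -> iota u = v ->
    affY n q0 i *: u = (y i)%:A *: u
}.

Section Intertwiner.
Variables (K : fieldType) (q : K) (l m : nat) (la mu : seq nat).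
Variables (Lam : stdTableau la l) (Mu : stdTableau mu m).

(* [genW], [eigW]: induction from V_Lam(z) (x) V_Mu(w);
   [genW'], [eigW']: induction from V_Mu(w) (x) V_Lam(z). *)
Definition genW : hecke q (l + m) :=
  heckeShift (leq_addr m l : 0 + l <= l + m)%N (fusionF q Lam)
  * heckeShift (leqnn (l + m)) (fusionF q Mu).

Definition eigW (z w : K) (i : nat) : K :=
  if (i <= l)%N then z * q ^ (2 * content Lam i)
  else w * q ^ (2 * content Mu (i - l)).

Definition genW' : hecke q (l + m) :=
  heckeShift (leq_addl l m : 0 + m <= l + m)%N (fusionF q Mu)
  * heckeShift (eq_leq (addnC m l)) (fusionF q Lam).

Definition eigW' (z w : K) (i : nat) : K :=
  if (i <= m)%N then w * q ^ (2 * content Mu i)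
  else z * q ^ (2 * content Lam (i - m)).

Definition elemS (z w : K) : hecke q (l + m) :=
  \prod_(i <- iota 1 l) \prod_(j <- rev (iota 1 m))
    heckeF q (l + m) (l + m - i - j + 1)
      (q ^ (2 * content Lam i) * z) (q ^ (2 * content Mu j) * w).

End Intertwiner.

Section ComplexRationalFunctions.
Variable R : realType.

(* The field C(q) and the indeterminate q. *)
Definition Cq : fieldType := {fraction {poly R[i]}}.
Definition qpar : Cq := tofrac 'X.

Lemma qpar_neq0 : qpar != 0.
Proof. by rewrite /qpar tofrac_eq0 polyX_eq0. Qed.

End ComplexRationalFunctions.

(* Main.v *)
From HB Require Import structures.
Require Import Defs.
From mathcomp Require Import all_boot all_order all_algebra.
From mathcomp Require Import reals boolp classical_sets.
From mathcomp Require Import ring zify ssrAC.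
From mathcomp Require mpoly monalg.
Import -(notations) monalg.
Import Order.TTheory GRing.Theory.
Local Open Scope ring_scope.

Set Implicit Arguments.
Unset Strict Implicit.
Unset Printing Implicit Defensive.

(** Write x_i = q^(2 c_i(Lam)) z and y_j = q^(2 c_j(Mu)) w.  The proof rests on
    two facts about the elements F_i(x, y).

    First, they satisfy the Yang-Baxter equation with spectral parameters, as
    long as the three parameters are non-zero and distinct.  Attach a parameter
    to each of l + m strands; the products of the F_i along two reduced words
    of the longest permutation then agree.  The equality
      F_Lam . shift F_Mu . S = S' . F_Mu . shift F_Lam
    is such an agreement ([halfTwist_crossProd]), except that distinct entries
    of a tableau on the same diagonal carry equal parameters, where neither the
    equation nor the product defining F_Lam makes sense.  So the variable of
    the entry i is moved to 1 + t q^col(i), where col(i) is the column of i.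
    This stays in the subspace where the fusion procedure takes place, and
    makes the parameters distinct for all but finitely many t, while no pole
    of S or S' is met at t = 0 because z^-1 w is not an even power of q.  Both
    sides are rational in t and regular at 0, and the field is infinite, hence
    their values at 0 agree too ([fusion_crossProd]).  This says that right
    multiplication by S maps W to W', and that it sends the generator of W to
    S' applied to the generator of W'.

    Second, F_i(x, y) is an intertwiner for the commuting Y: if Y_i and Y_(i+1)
    act on a vector by y and x, they act on its image under F_i(x, y) by x and
    y ([weights_heckeF]).  The factors of S' thus move the eigenvalues x past
    the eigenvalues y one at a time, and turn the eigenvalues of the generator
    of W' into those of the generator of W ([weights_crossProd]).

    So right multiplication by S commutes with the finite Hecke algebra, and
    with every Y_i on the generator of W.  The relations between the T_j and
    the Y_i propagate the latter from the generator to all of W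
    ([intertwines_generated]). *)

(** * Ordered products of solutions of the Yang-Baxter equation *)

Section YangBaxterProducts.
Variables (K : Type) (A : pzRingType) (f : nat -> K -> K -> A).

(** In the pictures behind these products, [f k x y] crosses the strands of
    parameters [x] and [y] in positions [k] and [k.+1].  Reading from right to
    left, [colProd k xs y] moves the strand [y] from the left of [xs] to its
    right, starting in position [k]. *)
Fixpoint colProd k (xs : seq K) (y : K) : A :=
  if xs is x :: xs' then colProd k.+1 xs' y * f k x y else 1.

(** Moves the strand [x] from the right of [ys] to its left. *)
Fixpoint rowProd k (x : K) (ys : seq K) : A :=
  if ys is y :: ys' then f k x y * rowProd k.+1 x ys' else 1.

(** Reverses all the strands.  The parameters are listed backwards: the
    product F_Lam of the fusion procedure is the half twist of the reversed
    list of its arguments, and this order turns the recursion over the last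
    entry into a structural one. *)
Fixpoint halfTwist k (rs : seq K) : A :=
  if rs is b :: rs' then halfTwist k rs' * colProd k rs' b else 1.

(** Moves all the strands [xs] from the right of [ys] to their left. *)
Fixpoint crossProd k (xs ys : seq K) : A :=
  if xs is x :: xs' then crossProd k.+1 xs' ys * rowProd k x ys else 1.

Lemma colProd_rcons k xs x y :
  colProd k (rcons xs x) y = f (k + size xs)%N x y * colProd k xs y.
Proof.
elim: xs k => [|x' xs IH] k /=; first by rewrite addn0 mul1r mulr1.
by rewrite IH addSnnS mulrA.
Qed.

Lemma rowProd_rcons k x ys y :
  rowProd k x (rcons ys y) = rowProd k x ys * f (k + size ys)%N x y.
Proof.
elim: ys k => [|y' ys IH] k /=; first by rewrite addn0 mul1r mulr1.
by rewrite IH addSnnS mulrA.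
Qed.

Definition commutesAt (a : A) (i : nat) := forall x y, GRing.comm a (f i x y).

Lemma comm_colProd a k xs y :
  (forall i, (k <= i < k + size xs)%N -> commutesAt a i) ->
  GRing.comm a (colProd k xs y).
Proof.
elim: xs k => [|x xs IH] k /= h; first exact: commr1.
apply: commrM; last by apply: h; lia.
by apply: IH => i hi; apply: h; lia.
Qed.

Lemma comm_rowProd a k x ys :
  (forall i, (k <= i < k + size ys)%N -> commutesAt a i) ->
  GRing.comm a (rowProd k x ys).
Proof.
elim: ys k => [|y ys IH] k /= h; first exact: commr1.
apply: commrM; first by apply: h; lia.
by apply: IH => i hi; apply: h; lia.
Qed.

Lemma comm_halfTwist a k rs :
  (forall i, (k <= i)%N -> (i.+1 < k + size rs)%N -> commutesAt a i) ->
  GRing.comm a (halfTwist k rs).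
Proof.
elim: rs => [|b rs IH] /= h; first exact: commr1.
apply: commrM; first by apply: IH => i hi hi'; apply: h; lia.
by apply: comm_colProd => i hi; apply: h; lia.
Qed.

Lemma comm_crossProd a k xs ys :
  (forall i, (k <= i)%N -> (i.+1 < k + size xs + size ys)%N -> commutesAt a i) ->
  GRing.comm a (crossProd k xs ys).
Proof.
elim: xs k => [|x xs IH] k /= h; first exact: commr1.
apply: commrM; first by apply: IH => i hi hi'; apply: h; lia.
by apply: comm_rowProd => i hi; apply: h; lia.
Qed.

Variables (r : rel K) (n : nat).
Hypothesis f_comm : forall i j x y x' y', (i.+2 <= j)%N ->
  f i x y * f j x' y' = f j x' y' * f i x y.
Hypothesis f_YB : forall i x y z, (0 < i)%N -> (i.+1 < n)%N ->
  r x y -> r x z -> r y z ->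
  f i x y * f i.+1 x z * f i y z = f i.+1 y z * f i x z * f i.+1 x y.

Let f_comm_gt i j x y : (i.+2 <= j)%N || (j.+2 <= i)%N -> commutesAt (f i x y) j.
Proof. by case/orP=> h x' y'; [apply: f_comm|apply/esym/f_comm]. Qed.

(** A third Reidemeister move with a bundle of strands: the crossing of [b] and
    [y] slides through [rs]. *)
Lemma colProd_exchange k rs b y :
  (0 < k)%N -> (k + size rs < n)%N ->
  all (fun x => r x b) rs -> all (fun x => r x y) rs -> r b y ->
  colProd k rs b * colProd k (b :: rs) y =
  colProd k (rcons rs b) y * colProd k.+1 rs b.
Proof.
elim: rs k => [|x rs IH] k k0 kn /=; first by rewrite !mul1r !mulr1.
case/andP=> xb rsb /andP[xy rsy] byr.
have c1 : GRing.comm (f k x b) (colProd k.+2 rs y).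
  by apply: comm_colProd => i hi; apply: f_comm_gt; lia.
have c2 : GRing.comm (f k x y) (colProd k.+2 rs b).
  by apply: comm_colProd => i hi; apply: f_comm_gt; lia.
have -> : colProd k.+1 rs b * f k x b *
    (colProd k.+2 rs y * f k.+1 x y * f k b y) =
  colProd k.+1 rs b * colProd k.+2 rs y * (f k x b * f k.+1 x y * f k b y).
  by rewrite !mulrA -(mulrA _ (f k x b)) c1 !mulrA.
rewrite f_YB //; last by move: kn => /=; lia.
have /= := IH k.+1; rewrite !mulrA => -> //; last by move: kn => /=; lia.
by rewrite -!mulrA (mulrA (colProd _ _ b)) -c2 !mulrA.
Qed.

(** Here the strand [x] slides over the column that moves [b] through [rs]. *)
Lemma rowProd_exchange k rs b x :
  (0 < k)%N -> (k + size rs < n)%N ->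
  all (fun y => r x y) rs -> all (fun y => r y b) rs -> r x b ->
  colProd k.+1 rs b * rowProd k x (b :: rs) =
  rowProd k x (rcons rs b) * colProd k rs b.
Proof.
elim: rs k => [|y rs IH] k k0 kn /=; first by rewrite !mul1r !mulr1.
case/andP=> xy rsx /andP[yb rsb] xb.
have c1 : GRing.comm (f k y b) (rowProd k.+2 x rs).
  by apply: comm_rowProd => i hi; apply: f_comm_gt; lia.
have c2 : GRing.comm (f k x y) (colProd k.+2 rs b).
  by apply: comm_colProd => i hi; apply: f_comm_gt; lia.
have -> : colProd k.+2 rs b * f k.+1 y b * (f k x b * (f k.+1 x y * rowProd k.+2 x rs))
  = colProd k.+2 rs b * (f k.+1 y b * f k x b * f k.+1 x y) * rowProd k.+2 x rs.
  by rewrite !mulrA.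
rewrite -f_YB //; last by move: kn => /=; lia.
rewrite !mulrA -c2 -!mulrA c1 !mulrA.
have /= := IH k.+1; rewrite !mulrA => E.
rewrite -(mulrA (f k x y) (colProd k.+2 rs b)) -(mulrA (f k x y)) E ?mulrA //.
by move: kn => /=; lia.
Qed.

(** A strand can pass under a half twist, which reverses the order in which
    the strand meets the others. *)
Lemma halfTwist_colProd k rs y :
  (0 < k)%N -> (k + size rs <= n)%N ->
  pairwise (fun a b => r b a) rs -> all (fun x => r x y) rs ->
  halfTwist k rs * colProd k rs y = colProd k (rev rs) y * halfTwist k.+1 rs.
Proof.
move=> k0; elim: rs => [|b rs IH] kn //=.
case/andP=> rb prs /andP[bry rsy].
have c : GRing.comm (f (k + size rs)%N b y) (halfTwist k rs).
  by apply: comm_halfTwist => i hi hi'; apply: f_comm_gt; lia.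
rewrite -mulrA.
rewrite colProd_exchange //; last by move: kn => /=; lia.
rewrite rev_cons !colProd_rcons !mulrA -c size_rev.
by rewrite -(mulrA _ (halfTwist _ _)) IH ?mulrA //; move: kn => /=; lia.
Qed.

Lemma halfTwist_rowProd k x rs :
  (0 < k)%N -> (k + size rs <= n)%N ->
  pairwise (fun a b => r b a) rs -> all (fun y => r x y) rs ->
  halfTwist k.+1 rs * rowProd k x rs = rowProd k x (rev rs) * halfTwist k rs.
Proof.
move=> k0; elim: rs => [|b rs IH] kn; first by rewrite /= !mulr1.
case/andP=> rb prs /andP[bry rsy].
have c : GRing.comm (f (k + size rs)%N x b) (halfTwist k rs).
  by apply: comm_halfTwist => i hi hi'; apply: f_comm_gt; lia.
rewrite [halfTwist k.+1 _]/= -mulrA rowProd_exchange //; last by move: kn => /=; lia.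
rewrite rev_cons !rowProd_rcons !mulrA IH //; last by move: kn => /=; lia.
by rewrite /= size_rev -!mulrA (mulrA (halfTwist _ _) (f _ _ _)) -c !mulrA.
Qed.

(** [crossProd] is defined row by row; this is its expansion by columns. *)
Lemma crossProd_cons k xs y ys :
  crossProd k xs (y :: ys) = colProd k xs y * crossProd k.+1 xs ys.
Proof.
elim: xs k => [|x xs IH] k /=; first by rewrite mulr1.
have c : GRing.comm (f k x y) (crossProd k.+2 xs ys).
  by apply: comm_crossProd => i hi hi'; apply: f_comm_gt; lia.
by rewrite IH -!mulrA (mulrA (crossProd _ _ _)) -c !mulrA.
Qed.

Lemma crossProd_nil k xs : crossProd k xs [::] = 1.
Proof. by elim: xs k => //= x xs IH k; rewrite IH mulr1. Qed.

Lemma halfTwist_crossProd_l k rx ys :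
  (0 < k)%N -> (k + size rx + size ys <= n.+1)%N ->
  pairwise (fun a b => r b a) rx -> allrel r rx ys ->
  halfTwist k rx * crossProd k rx ys =
  crossProd k (rev rx) ys * halfTwist (k + size ys) rx.
Proof.
move=> + + prx; elim: ys k => [|y ys IH] k k0 kn.
  by rewrite !crossProd_nil addn0 mulr1 mul1r.
rewrite allrel_consr => /andP[ry rys].
rewrite !crossProd_cons mulrA halfTwist_colProd //; last by move: kn => /=; lia.
by rewrite -mulrA IH ?mulrA ?addSnnS //; move: kn => /=; lia.
Qed.

Lemma halfTwist_crossProd_r k xs ry :
  (0 < k)%N -> (k + size xs + size ry <= n.+1)%N ->
  pairwise (fun a b => r b a) ry -> allrel r xs ry ->
  halfTwist (k + size xs) ry * crossProd k xs ry =
  crossProd k xs (rev ry) * halfTwist k ry.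
Proof.
move=> + + pry; elim: xs k => [|x xs IH] k k0 kn.
  by rewrite addn0 mulr1 mul1r.
rewrite allrel_consl => /andP[ry' rys].
rewrite /= -addSnnS mulrA IH //; last by move: kn => /=; lia.
by rewrite -!mulrA halfTwist_rowProd //; move: kn => /=; lia.
Qed.

(** Both sides describe the half twist of all the strands: either each bundle
    is twisted last and the bundles cross first, or conversely. *)
Theorem halfTwist_crossProd k rx ry :
  (0 < k)%N -> (k + size rx + size ry <= n.+1)%N ->
  pairwise (fun a b => r b a) rx -> pairwise (fun a b => r b a) ry ->
  allrel r rx ry ->
  halfTwist k rx * halfTwist (k + size rx) ry * crossProd k rx ry =
  crossProd k (rev rx) (rev ry) * (halfTwist k ry * halfTwist (k + size ry) rx).
Proof.
move=> k0 kn px py rxy.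
rewrite -mulrA halfTwist_crossProd_r // mulrA halfTwist_crossProd_l ?size_rev //.
  rewrite -!mulrA; congr (_ * _).
  apply: comm_halfTwist => i hi hi' x y; apply/commr_sym.
  by apply: comm_halfTwist => j hj hj'; apply: f_comm_gt; lia.
by rewrite /allrel (eq_all (fun x => all_rev (r x) ry)).
Qed.
End YangBaxterProducts.

(** * The Yang-Baxter equation in the Hecke algebra *)

(** The condition under which F_i(x, y) is defined by a non-degenerate
    fraction, and its parameters may be used in the Yang-Baxter equation. *)
Definition separated {K : fieldType} (x y : K) := [&& x != 0, y != 0 & x != y].

(** With [a] and [b] generators of a Hecke algebra, expanding both sides and
    applying the braid and quadratic relations leaves a multiple of [a - b],
    whose coefficient is the difference of the sides of the last hypothesis. *)
Lemma braid_YangBaxter (K : fieldType) (A : algType K) (s al be ga : K) (a b : A) :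
  a * b * a = b * a * b -> a * a = s *: a + 1 -> b * b = s *: b + 1 ->
  al * ga = be * s + be * ga + al * be ->
  (a + al%:A) * (b + be%:A) * (a + ga%:A) =
  (b + ga%:A) * (a + be%:A) * (b + al%:A).
Proof.
move=> ab aa bb E.
rewrite !(mulrDl, mulrDr) -!(scalerAl, scalerAr) !(mul1r, mulr1) -?(scalerAl, scalerAr).
rewrite ab aa bb !scalerA !(scalerDl, scalerDr) !scalerA (mulrC ga al) E.
rewrite !(scalerDl, scalerDr).
rewrite (mulrC ga be) (mulrC be al) (_ : be * ga * al = al * be * ga); last by ring.
(* Both sides consist of the same eleven terms. *)
by rewrite !addrA [LHS](ACl (1*8*3*6*9*4*10*2*7*5*11)).
Qed.

Lemma quad_sqr (K : fieldType) (A : algType K) (q : K) (a : A) : q != 0 ->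
  (a - q%:A) * (a + q^-1%:A) = 0 -> a * a = (q - q^-1) *: a + 1.
Proof.
move=> q0; rewrite mulrBl !mulrDr -!scalerAl -!scalerAr !mul1r !mulr1 scalerA.
rewrite mulfV // scale1r => /eqP; rewrite subr_eq0 => /eqP E.
by rewrite scalerBl addrAC -E addrK.
Qed.

Lemma comm_scalar (K : fieldType) (A : algType K) (a : A) (c : K) : GRing.comm a c%:A.
Proof. by rewrite /GRing.comm -scalerAr -scalerAl mul1r mulr1. Qed.

Section HeckeBaxter.
Variables (K : fieldType) (q : K) (n : nat).

Lemma heckeT_out i : ~~ (0 < i < n)%N -> heckeT q n i = 0.
Proof. by move=> hi; rewrite /heckeT /genAt insubN. Qed.

(** Generators out of range are 0, hence commute with everything. *)
Lemma heckeT_comm i j : (i.+2 <= j)%N -> GRing.comm (heckeT q n i) (heckeT q n j).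
Proof.
move=> ij; have [hi|/heckeT_out->] := boolP (0 < i < n)%N; last exact/commr_sym/commr0.
have [hj|/heckeT_out->] := boolP (0 < j < n)%N; last exact/commr0.
by apply: heckeP; apply: HeckeComm; rewrite ?ij.
Qed.

Lemma heckeF_comm i j x y x' y' : (i.+2 <= j)%N ->
  heckeF q n i x y * heckeF q n j x' y' = heckeF q n j x' y' * heckeF q n i x y.
Proof.
move=> ij; apply: commrD; last exact: comm_scalar.
by apply/commr_sym/commrD; [apply/commr_sym/heckeT_comm|exact: comm_scalar].
Qed.

Lemma heckeT_sqr i : q != 0 -> (0 < i < n)%N ->
  heckeT q n i * heckeT q n i = (q - q^-1) *: heckeT q n i + 1.
Proof.
by move=> q0 hi; apply: quad_sqr q0 _; apply: heckeP; apply: HeckeQuad.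
Qed.

Lemma heckeF_YB i x y z : q != 0 -> (0 < i)%N -> (i.+1 < n)%N ->
  separated x y -> separated x z -> separated y z ->
  heckeF q n i x y * heckeF q n i.+1 x z * heckeF q n i y z =
  heckeF q n i.+1 y z * heckeF q n i x z * heckeF q n i.+1 x y.
Proof.
move=> q0 i0 hi /and3P[x0 y0 xy] /and3P[_ z0 xz] /and3P[_ _ yz].
have hi' : (0 < i < n)%N by lia.
apply: (@braid_YangBaxter _ _ (q - q^-1)); last first.
- have d (u v : K) : u != 0 -> u != v -> u^-1 * v - 1 = (v - u) / u.
    by move=> u0 uv; field.
  rewrite !d //; field; rewrite x0 y0 q0 ?subr_eq0 /=.
  by rewrite ?[y == x]eq_sym ?[z == x]eq_sym ?[z == y]eq_sym xy xz yz.
- by apply: heckeT_sqr.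
- by apply: heckeT_sqr.
- by apply: heckeP; apply: HeckeBraid.
Qed.
End HeckeBaxter.

(** * The products of the fusion procedure as twists and crossings *)

Section Transport.
Variables (K : Type) (A B : pzRingType) (phi : {rmorphism A -> B}).
Variables (f : nat -> K -> K -> A) (f' : nat -> K -> K -> B) (s n : nat).
Hypothesis phif : forall i x y, (0 < i < n)%N -> phi (f i x y) = f' (s + i)%N x y.

Lemma map_colProd k xs y : (0 < k)%N -> (k + size xs <= n)%N ->
  phi (colProd f k xs y) = colProd f' (s + k) xs y.
Proof.
elim: xs k => [|x xs IH] k k0 kn /=; first exact: rmorph1.
by rewrite rmorphM IH ?phif ?addnS //; move: kn => /=; lia.
Qed.

Lemma map_halfTwist k rs : (0 < k)%N -> (k + size rs <= n.+1)%N ->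
  phi (halfTwist f k rs) = halfTwist f' (s + k) rs.
Proof.
elim: rs => [|b rs IH] k0 kn /=; first exact: rmorph1.
by rewrite rmorphM IH ?map_colProd //; move: kn => /=; lia.
Qed.
End Transport.

Section Reindex.
Variables (K : Type) (A : pzRingType) (f : nat -> K -> K -> A).

Lemma colProd_map (g : K -> K) k xs y : (forall i x y, f i (g x) (g y) = f i x y) ->
  colProd f k (map g xs) (g y) = colProd f k xs y.
Proof. by move=> gf; elim: xs k => //= x xs IH k; rewrite IH gf. Qed.

Lemma halfTwist_map (g : K -> K) k rs : (forall i x y, f i (g x) (g y) = f i x y) ->
  halfTwist f k (map g rs) = halfTwist f k rs.
Proof. by move=> gf; elim: rs => //= b rs IH; rewrite IH colProd_map. Qed.

Lemma colProd_mkseq k (a : nat -> K) n y :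
  colProd f k (rev (mkseq a n)) y =
  \prod_(0 <= i < n) f (k + n.-1 - i)%N (a i) y.
Proof.
elim: n k => [|n IH] k; first by rewrite big_nil.
rewrite mkseqS rev_rcons /= IH big_nat_recr //= addnK; congr (_ * _).
by apply: eq_big_nat => i hi; congr f; lia.
Qed.

Lemma halfTwist_mkseq (a : nat -> K) n :
  halfTwist f 1 (rev (mkseq a n)) =
  \prod_(0 <= j < n) \prod_(0 <= i < j) f (j - i)%N (a i) (a j).
Proof.
elim: n => [|n IH]; first by rewrite big_nil.
rewrite mkseqS rev_rcons /= IH big_nat_recr //=; congr (_ * _).
by rewrite colProd_mkseq; apply: eq_big_nat => i hi; congr f; lia.
Qed.

Lemma rowProd_rev_iota k x (h : nat -> K) m :
  rowProd f k x (rev (map h (iota 1 m))) =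
  \prod_(j <- rev (iota 1 m)) f (k + m - j)%N x (h j).
Proof.
elim: m k => [|m IH] k; first by rewrite big_nil.
rewrite -[m.+1]addn1 iotaD map_cat !rev_cat /= big_cons IH; congr (f _ _ _ * _).
  by lia.
by apply: eq_bigr => j _; congr f; lia.
Qed.

Lemma crossProd_rev_iota k (g : nat -> K) l ys :
  crossProd f k (rev (map g (iota 1 l))) ys =
  \prod_(i <- iota 1 l) rowProd f (k + l - i) (g i) ys.
Proof.
elim: l k => [|l IH] k; first by rewrite big_nil.
rewrite -[l.+1]addn1 iotaD map_cat rev_cat /= big_cat big_seq1 IH; congr (_ * _).
  by apply: eq_bigr => j _; congr rowProd; lia.
by congr rowProd; lia.
Qed.
End Reindex.

Section HeckeProducts.
Variables (K : fieldType) (q : K).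

Lemma heckeF_scale n c i x y : c != 0 ->
  heckeF q n i (c * x) (c * y) = heckeF q n i x y.
Proof.
by move=> c0; rewrite /heckeF invfM mulrACA mulVf // mul1r.
Qed.

Lemma heckeShift_halfTwist k n s (skn : (s + k <= n)%N) rs : (size rs <= k)%N ->
  heckeShift (q := q) skn (halfTwist (heckeF q k) 1 rs) =
  halfTwist (heckeF q n) s.+1 rs.
Proof.
move=> hk; rewrite (@map_halfTwist K _ _ (@heckeShift K q k n s skn)
  (heckeF q k) (heckeF q n) s k) ?addn1 // => i x y hi.
by rewrite /heckeF rmorphD /= linearZ /= rmorph1 heckeShiftT.
Qed.

Lemma elemS_crossProd l m la mu (Lam : stdTableau la l) (Mu : stdTableau mu m) z w :
  elemS q Lam Mu z w =
  crossProd (heckeF q (l + m)) 1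
    (rev [seq q ^ (2 * content Lam i) * z | i <- iota 1 l])
    (rev [seq q ^ (2 * content Mu j) * w | j <- iota 1 m]).
Proof.
rewrite crossProd_rev_iota /elemS; apply: eq_big_seq => i.
rewrite mem_iota => hi; rewrite rowProd_rev_iota; apply: eq_big_seq => j.
by rewrite mem_rev mem_iota => hj; congr heckeF; lia.
Qed.

Lemma tabF_halfTwist la l (L : stdTableau la l) (u : nat -> K) :
  tabF q L (fun i => u i.+1) =
  halfTwist (heckeF q l) 1
    (rev [seq q ^ (2 * content L i) * u i | i <- iota 1 l]).
Proof.
pose a i := q ^ (2 * content L i.+1) * u i.+1.
have -> : [seq q ^ (2 * content L i) * u i | i <- iota 1 l] = mkseq a l.
  by rewrite (iotaDl 1 0) -map_comp.
rewrite halfTwist_mkseq big_mkord; apply: eq_bigr => j _.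
rewrite big_mkord (big_ord_widen l (fun i => heckeF q l (j - i) (a i) (a j))) //.
exact: ltnW.
Qed.
End HeckeProducts.

(** * Values at 0 of rational functions of one variable *)

Section Generically.
Variable K : fieldType.

(** Valid outside the roots of a non-zero polynomial, that is for all but
    finitely many values. *)
Definition generically (Q : K -> Prop) :=
  exists2 e : {poly K}, e != 0 & forall t, e.[t] != 0 -> Q t.

Lemma generically_all (Q : K -> Prop) : (forall t, Q t) -> generically Q.
Proof. by exists 1; rewrite ?oner_eq0. Qed.

Lemma generically_and (Q Q' : K -> Prop) :
  generically Q -> generically Q' -> generically (fun t => Q t /\ Q' t).
Proof.
move=> [e e0 eQ] [e' e'0 eQ']; exists (e * e'); first by rewrite mulf_neq0.
by move=> t; rewrite hornerM mulf_eq0 negb_or => /andP[/eQ ? /eQ'].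
Qed.

Lemma generically_sub (Q Q' : K -> Prop) :
  (forall t, Q t -> Q' t) -> generically Q -> generically Q'.
Proof. by move=> QQ' [e e0 eQ]; exists e => // t /eQ /QQ'. Qed.

Lemma generically_seq (I : eqType) (s : seq I) (Q : I -> K -> Prop) :
  (forall i, i \in s -> generically (Q i)) ->
  generically (fun t => forall i, i \in s -> Q i t).
Proof.
elim: s => [|i s IH] h; first by apply: generically_all.
have hi := h i (mem_head _ _).
have hs : generically (fun t => forall i, i \in s -> Q i t).
  by apply: IH => j js; apply: h; rewrite inE js orbT.
apply: generically_sub (generically_and hi hs) => t [Qi Qs] j.
by rewrite inE => /predU1P[->//|/Qs].
Qed.

Lemma generically_neq (p p' : {poly K}) : p != p' ->
  generically (fun t => p.[t] != p'.[t]).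
Proof.
move=> pp'; exists (p - p') => [|t]; first by rewrite subr_eq0.
by rewrite hornerD hornerN subr_eq0.
Qed.

Lemma generically_separated (p p' : {poly K}) : p != 0 -> p' != 0 -> p != p' ->
  generically (fun t => separated p.[t] p'.[t]).
Proof.
move=> p0 p'0 pp'; have := generically_and (generically_neq p'0) (generically_neq pp').
move/(generically_and (generically_neq p0)); apply: generically_sub => t.
by rewrite !horner0 /separated => -[-> [-> ->]].
Qed.

Lemma separated_generically (p p' : {poly K}) : separated p.[0] p'.[0] ->
  generically (fun t => separated p.[t] p'.[t]).
Proof.
case/and3P=> p0 p'0 pp'; apply: generically_separated.
- by apply: contra_neq p0 => ->; rewrite horner0.
- by apply: contra_neq p'0 => ->; rewrite horner0.
- by apply: contra_neq pp' => ->.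
Qed.

(** [f] agrees generically with a fraction P / d without pole at 0, whose value
    there is [v].  The numerator has its coefficients in the algebra, so its
    argument is the scalar [t%:A]; scalars being central, evaluation at it is
    multiplicative. *)
Definition regularAt0 (A : algType K) (f : K -> A) (v : A) : Prop :=
  exists (d : {poly K}) (P : {poly A}),
    [/\ d.[0] != 0, generically (fun t => d.[t] *: f t = P.[t%:A])
      & d.[0] *: v = P.[0]].

Lemma regularAt0_cst (A : algType K) (v : A) : regularAt0 (fun=> v) v.
Proof.
exists 1, v%:P; split; rewrite ?hornerC ?oner_eq0 ?scale1r //.
by apply: generically_all => t; rewrite !hornerC scale1r.
Qed.

Lemma regularAt0M (A : algType K) (f g : K -> A) v w :
  regularAt0 f v -> regularAt0 g w -> regularAt0 (fun t => f t * g t) (v * w).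
Proof.
move=> [d [P [d0 fP vP]]] [d' [P' [d'0 gP wP]]]; exists (d * d'), (P * P').
have cP t : comm_poly P' (t%:A : A) by exact/esym/comm_scalar.
split; first by rewrite hornerM mulf_neq0.
  apply: generically_sub (generically_and fP gP) => t [ft gt].
  by rewrite hornerM hornerM_comm // -ft -gt -scalerAl -scalerAr scalerA.
have := cP 0; rewrite scale0r => cP0.
by rewrite hornerM hornerM_comm // -vP -wP -scalerAl -scalerAr scalerA.
Qed.

Lemma regularAt0_map (A B : algType K) (phi : {lrmorphism A -> B}) f v :
  regularAt0 f v -> regularAt0 (phi \o f) (phi v).
Proof.
move=> [d [P [d0 fP vP]]]; exists d, (map_poly phi P).
have E t : (map_poly phi P).[t%:A] = phi P.[t%:A].
  by rewrite -horner_map /= linearZ /= rmorph1.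
split=> //; last by have := E 0; rewrite !scale0r -vP linearZ.
by apply: generically_sub fP => t ft; rewrite E -ft linearZ.
Qed.

Lemma regularAt0_generic (A : algType K) (f g : K -> A) v :
  generically (fun t => f t = g t) -> regularAt0 f v -> regularAt0 g v.
Proof.
move=> fg [d [P [d0 fP vP]]]; exists d, P; split=> //.
by apply: generically_sub (generically_and fg fP) => t [-> ->].
Qed.

Variables (q : K) (q_inj : injective (fun i => q ^+ i)).

(** The powers of [q] are infinitely many points to choose from. *)
Lemma generically_ex (Q : K -> Prop) : generically Q -> exists t, Q t.
Proof.
case=> e e0 eQ; pose s := [seq q ^+ i | i <- iota 0 (size e)].
have us : uniq s by rewrite map_inj_uniq ?iota_uniq.
have [/(max_poly_roots e0)/(_ us)|] := boolP (all (root e) s).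
  by rewrite size_map size_iota ltnn.
by case/allPn => t _ /eQ Qt; exists t.
Qed.

(** A non-commutative version of the bound on the number of roots: central roots
    whose differences are units can be divided out one after the other. *)
Lemma generic_root_eq0 (A : algType K) (P : {poly A}) :
  generically (fun t => P.[t%:A] = 0) -> P = 0.
Proof.
have [n] := ubnP (size P); elim: n P => // n IH P hP gP.
have [//|P0] := eqVneq P 0.
have [t Pt] := generically_ex gP.
have /factor_theorem [Q E] : root P t%:A by apply/eqP.
have Q0 : Q = 0.
  apply: IH; last first.
    have tX : generically (fun t' => 'X.[t'] != t%:P.[t']).
      by apply: generically_neq; rewrite -subr_eq0 polyXsubC_eq0.
    apply: generically_sub (generically_and gP tX) => t' [].
    have -> : P.[t'%:A] = (t' - t) *: Q.[t'%:A].
      rewrite E hornerM_comm /comm_poly hornerXsubC -scalerBl.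
        by rewrite -scalerAr mulr1.
      exact: comm_scalar.
    rewrite hornerX hornerC => /eqP + t't.
    by rewrite scaler_eq0 subr_eq0 (negPf t't) => /eqP.
  have [Q0|Q0] := eqVneq Q 0; first by rewrite E Q0 mul0r eqxx in P0.
  by move: hP; rewrite E size_Mmonic ?monicXsubC // size_XsubC addn2.
by rewrite E Q0 mul0r.
Qed.

(** This is what lets an identity between generic values pass to the limit. *)
Lemma regularAt0_unique (A : algType K) (f : K -> A) v w :
  regularAt0 f v -> regularAt0 f w -> v = w.
Proof.
move=> [d [P [d0 fP vP]]] [d' [P' [d'0 gP wP]]].
have E (p : {poly K}) t : (map_poly (in_alg A) p).[t%:A] = (p.[t])%:A.
  by rewrite -[t%:A]/(in_alg A t) horner_map.
have : (map_poly (in_alg A) d') * P - (map_poly (in_alg A) d) * P' = 0.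
  apply: generic_root_eq0.
  apply: generically_sub (generically_and fP gP) => t [ft gt].
  rewrite hornerD hornerN !hornerM_comm; last 2 first.
  - exact/esym/comm_scalar.
  - exact/esym/comm_scalar.
  by rewrite !E -ft -gt -!scalerAl !mul1r !scalerA mulrC subrr.
move/(congr1 (fun P => P.[0%:A])).
rewrite hornerD hornerN !hornerM_comm; last 2 first.
- exact/esym/comm_scalar.
- exact/esym/comm_scalar.
rewrite !E !scale0r -vP -wP -!scalerAl !mul1r !scalerA (mulrC d.[0]) horner0.
move/eqP; rewrite -scalerBr scaler_eq0 mulf_eq0 (negPf d0) (negPf d'0) subr_eq0.
by move/eqP.
Qed.

End Generically.

Section Evaluations.
Variables (K : fieldType).

Lemma meval_path n (p : 'I_n -> {poly K}) (d : mpoly.mpoly n K) :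
  exists P : {poly K}, forall t, mpoly.meval (fun i => (p i).[t]) d = P.[t].
Proof.
exists (mpoly.mmap polyC p d) => t; rewrite /mpoly.meval /mpoly.mmap horner_sum.
apply: eq_bigr => m _; rewrite hornerM hornerC; congr (_ * _).
rewrite /mpoly.mmap1 horner_prod; by apply: eq_bigr => i _; rewrite horner_exp.
Qed.

(** A value given by the fusion procedure can be computed along any polynomial
    path that generically stays in the domain. *)
Lemma regularValue_path (A : algType K) n (D : set ('I_n -> K)) (f : ('I_n -> K) -> A)
    (p : 'I_n -> {poly K}) v :
  regularValue D f (fun i => (p i).[0]) v ->
  generically (fun t => D (fun i => (p i).[t])) ->
  regularAt0 (fun t => f (fun i => (p i).[t])) v.
Proof.
move=> [d [s [d0 fs ->]]] gD.
have [d' d'E] := meval_path p d.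
have [P PE] : exists P : {poly A}, forall t,
    \sum_(u <- s) mpoly.meval (fun i => (p i).[t]) u.1 *: u.2 = P.[t%:A].
  elim: (s) => [|[c a] s' [P PE]]; first by exists 0 => t; rewrite big_nil horner0.
  have [c' c'E] := meval_path p c.
  exists (a%:P * map_poly (in_alg A) c' + P) => t.
  rewrite big_cons PE hornerD hornerCM -[t%:A]/(in_alg A t) horner_map c'E.
  by rewrite /= -scalerAr mulr1.
exists d', P; split; first by rewrite -d'E.
  by apply: generically_sub gD => t Dt; rewrite -d'E -PE fs.
by rewrite -[X in P.[X]](scale0r 1) -PE -d'E scalerA mulfV ?scale1r.
Qed.

(** Multiplying F_i(x, y) by [y - x] clears its denominator. *)
Lemma regularAt0_heckeF (q : K) n i (x y : {poly K}) :
  separated x.[0] y.[0] ->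
  regularAt0 (fun t => heckeF q n i x.[t] y.[t]) (heckeF q n i x.[0] y.[0]).
Proof.
move=> xy; have /and3P[x0 _ xy0] := xy.
pose P : {poly hecke q n} := (heckeT q n i)%:P * map_poly (in_alg _) (y - x)
  + map_poly (in_alg _) ((q - q^-1) *: x).
have E t : x.[t] != 0 -> x.[t] != y.[t] ->
    (y - x).[t] *: heckeF q n i x.[t] y.[t] = P.[t%:A].
  move=> xt xyt; rewrite /P [RHS]hornerD hornerCM -[t%:A]/(in_alg _ t) !horner_map /=.
  rewrite scalerDr scalerA -scalerAr mulr1; congr (_ + _ *: _).
  rewrite hornerD hornerN hornerZ; move: (q - q^-1) => s.
  by field; rewrite xt mulN1r subr_eq0 eq_sym.
exists (y - x), P; split; first by rewrite !hornerE subr_eq0 eq_sym.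
  apply: generically_sub (separated_generically xy) => t.
  by case/and3P=> xt _ xyt; apply: E.
by rewrite E // scale0r.
Qed.

Section Products.
Variables (A : algType K) (f : nat -> K -> K -> A).
Hypothesis f_reg : forall i (x y : {poly K}), separated x.[0] y.[0] ->
  regularAt0 (fun t => f i x.[t] y.[t]) (f i x.[0] y.[0]).
Definition evalAt (t : K) (ps : seq {poly K}) := [seq p.[t] | p <- ps].

Lemma regularAt0_rowProd k (x : {poly K}) ys : all (separated x.[0]) (evalAt 0 ys) ->
  regularAt0 (fun t => rowProd f k x.[t] (evalAt t ys)) (rowProd f k x.[0] (evalAt 0 ys)).
Proof.
elim: ys k => [|y ys IH] k /=; first by move=> _; apply: regularAt0_cst.
by case/andP=> xy xys; apply: regularAt0M; [apply: f_reg|apply: IH].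
Qed.

Lemma regularAt0_crossProd k xs ys : allrel separated (evalAt 0 xs) (evalAt 0 ys) ->
  regularAt0 (fun t => crossProd f k (evalAt t xs) (evalAt t ys))
    (crossProd f k (evalAt 0 xs) (evalAt 0 ys)).
Proof.
elim: xs k => [|x xs IH] k /=; first by move=> _; apply: regularAt0_cst.
by case/andP=> xy xys; apply: regularAt0M; [apply: IH|apply: regularAt0_rowProd].
Qed.
End Products.
End Evaluations.

(** * Contents and columns of the entries of a tableau *)

Section Tableaux.
Variables (la : seq nat) (l : nat) (L : stdTableau la l).

Lemma cellOfP i : (0 < i <= l)%N -> young la (cellOf L i) /\ L (cellOf L i) = i.
Proof.
move=> hi; apply: (@xgetPex _ (0, 0)%N [set ab | young la ab /\ L ab = i]).
by case: (entry_bij L) => _ _ /(_ i hi) [ab yab <-]; exists ab.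
Qed.

Lemma content_col_inj i j : (0 < i <= l)%N -> (0 < j <= l)%N ->
  content L i = content L j -> (cellOf L i).2 = (cellOf L j).2 -> i = j.
Proof.
move=> /cellOfP [_ Li] /cellOfP [_ Lj] cij col; rewrite -Li -Lj; congr (L _).
move: cij col; rewrite /content.
case: (cellOf L i) (cellOf L j) => [a b] [a' b'] /= + bb'.
by rewrite bb' => /addrI/oppr_inj[->].
Qed.
End Tableaux.

(** * Fusion *)

Section Fusion.
Variables (K : fieldType) (q : K).
Hypotheses (q0 : q != 0) (q_inj : injective (fun i => q ^+ i)).

Lemma exprz_inj : injective (fun i : int => q ^ i).
Proof.
have h (n : nat) (i : int) : q ^ (i + n%:Z) = q ^ i -> n = 0%N.
  rewrite expfzDr // => /(congr1 (fun x => x / q ^ i)).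
  rewrite mulrAC mulfV ?expfz_neq0 // mul1r => E.
  by apply: q_inj; rewrite /= expr0.
move=> i j /=; wlog ij : i j / (i <= j)%R.
  by move=> W E; case/orP: (le_total i j) => [/W->|/W->].
have -> : j = i + `|j - i|%N%:Z by lia.
by move/esym/h => ->; rewrite addr0.
Qed.

Section Path.
Variables (la : seq nat) (l : nat) (L : stdTableau la l).

(** A line through the point 1.  Its slope depends on the column only, so that
    the path stays in the column subspace, and differs between columns. *)
Definition colPath i : {poly K} := 1 + q ^+ (cellOf L i).2 *: 'X.
Definition tabPath := [seq q ^ (2 * content L i) *: colPath i | i <- iota 1 l].

Lemma colPath0 i : (colPath i).[0] = 1.
Proof. by rewrite hornerD hornerZ hornerX mulr0 addr0 hornerC. Qed.

Lemma tabPath0 : evalAt 0 tabPath = [seq q ^ (2 * content L i) | i <- iota 1 l].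
Proof.
by rewrite /evalAt -map_comp; apply: eq_map => i /=; rewrite hornerZ colPath0 mulr1.
Qed.

Lemma scaled_colPath_neq0 i : q ^ (2 * content L i) *: colPath i != 0.
Proof.
apply/eqP => /(congr1 (fun p => p.[0])); rewrite hornerZ colPath0 horner0 mulr1.
by apply/eqP; rewrite expfz_neq0.
Qed.

Lemma scaled_colPath_inj i j : (0 < i <= l)%N -> (0 < j <= l)%N ->
  q ^ (2 * content L i) *: colPath i = q ^ (2 * content L j) *: colPath j -> i = j.
Proof.
move=> hi hj E; have := congr1 (fun p => p.[0]) E.
rewrite !hornerZ !colPath0 !mulr1 => Ec; move/exprz_inj: (Ec) => cij.
apply: (@content_col_inj _ _ L) => //; first by lia.
apply: q_inj => /=; have := congr1 (fun p : {poly K} => p`_1) E.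
rewrite Ec !coefZ !coefD !coefZ !coefX coef1 !add0r !mulr1.
by apply: mulfI; rewrite expfz_neq0.
Qed.

(** Entries of equal content lie in different columns, and there the slopes of
    the paths differ; entries of different contents are distinct at 0. *)
Lemma tabPath_separated : generically (fun t => {in iota 1 l &, forall i j,
  i != j -> separated (q ^ (2 * content L i) *: colPath i).[t]
                      (q ^ (2 * content L j) *: colPath j).[t]}).
Proof.
have h i j : i \in iota 1 l -> j \in iota 1 l -> generically (fun t => i != j ->
    separated (q ^ (2 * content L i) *: colPath i).[t]
              (q ^ (2 * content L j) *: colPath j).[t]).
  rewrite !mem_iota => hi hj; have [->|ij] := eqVneq i j.
    exact: generically_all.
  have ne : q ^ (2 * content L i) *: colPath i != q ^ (2 * content L j) *: colPath j.
    by apply: contra_neq ij; apply: scaled_colPath_inj; lia.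
  have := generically_separated (scaled_colPath_neq0 i) (scaled_colPath_neq0 j) ne.
  by apply: generically_sub.
have := generically_seq (fun i hi => generically_seq (fun j hj => h i j hi hj)).
by apply: generically_sub => t ht i j hi hj; apply: ht.
Qed.

Lemma pairwise_tabPath : generically (fun t =>
  pairwise (fun a b => separated b a) (rev (evalAt t tabPath))).
Proof.
apply: generically_sub tabPath_separated => t ht.
rewrite /evalAt -map_comp -map_rev pairwise_map.
apply: (@sub_in_pairwise _ (mem (iota 1 l)) (fun i j => i != j)).
- by move=> i j hi hj ij /=; apply: ht; rewrite // eq_sym.
- by apply/allP => i; rewrite mem_rev.
- by rewrite -uniq_pairwise rev_uniq iota_uniq.
Qed.

(** [fusionF] is 0 by convention if the fusion procedure has no value; the
    first alternative covers that case, in which both sides of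
    [fusion_crossProd] vanish. *)
Lemma fusionF_regular : fusionF q L = 0 \/
  regularAt0 (fun t => halfTwist (heckeF q l) 1 (rev (evalAt t tabPath)))
    (fusionF q L).
Proof.
rewrite /fusionF; case: xgetP => [v _ hv|_]; [right|by left].
have E t : halfTwist (heckeF q l) 1 (rev (evalAt t tabPath)) =
    tabF q L (fun i => (colPath i.+1).[t]).
  rewrite (tabF_halfTwist q L (fun i => (colPath i).[t])) /evalAt -map_comp.
  by congr (halfTwist _ _ (rev _)); apply: eq_map => i /=; rewrite hornerZ.
under eq_fun do rewrite E.
apply: (@regularValue_path _ _ _ (colSpace L `&` tabFdom q L)%classic _
  (fun i => colPath i.+1)).
  by under eq_fun do rewrite colPath0.
apply: generically_sub tabPath_separated => t ht; split=> [i j|i j ij].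
  by rewrite /colPath => ->.
have li := ltn_ord i; have lj := ltn_ord j.
have := ht i.+1 j.+1; rewrite !mem_iota !hornerZ.
move=> /(_ _ _ _)/and3P[||| i0 j0 nij]; try by lia.
split=> //; apply: contra_neq nij => tE.
by rewrite -[LHS]mulr1 -tE mulVKf.
Qed.
End Path.

Lemma content_separated l m la mu (Lam : stdTableau la l) (Mu : stdTableau mu m)
    (z w : K) (ii jj : seq nat) :
  z != 0 -> w != 0 -> (forall k : int, z^-1 * w != q ^ (2 * k)) ->
  allrel separated [seq q ^ (2 * content Lam i) * z | i <- ii]
    [seq q ^ (2 * content Mu j) * w | j <- jj].
Proof.
move=> z0 w0 zw; apply/allrelP => _ _ /mapP[i _ ->] /mapP[j _ ->].
rewrite /separated !mulf_neq0 ?expfz_neq0 //=.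
apply: contra_neq (zw (content Lam i - content Mu j)) => E.
apply: (@mulIf _ (q ^ (2 * content Mu j))); first by rewrite expfz_neq0.
by rewrite -expfzDr // -mulrDr subrK -mulrA (mulrC w) -E mulrCA mulVf // mulr1.
Qed.

(** [halfTwist_crossProd] holds along the paths for generic [t], and both sides
    are regular at 0, where they take the values below. *)
Theorem fusion_crossProd l m la mu (Lam : stdTableau la l) (Mu : stdTableau mu m)
    (z w : K) :
  z != 0 -> w != 0 -> (forall k : int, z^-1 * w != q ^ (2 * k)) ->
  genW q Lam Mu * elemS q Lam Mu z w =
  crossProd (heckeF q (l + m)) 1
    [seq q ^ (2 * content Lam i) * z | i <- iota 1 l]
    [seq q ^ (2 * content Mu j) * w | j <- iota 1 m] * genW' q Lam Mu.
Proof.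
move=> z0 w0 zw; rewrite elemS_crossProd /genW /genW'.
have [->|regL] := fusionF_regular Lam; first by rewrite !raddf0 !(mul0r, mulr0).
have [->|regM] := fusionF_regular Mu; first by rewrite !raddf0 !(mul0r, mulr0).
pose xs : seq {poly K} := [seq z *: p | p <- tabPath Lam].
pose ys : seq {poly K} := [seq w *: p | p <- tabPath Mu].
have ev t c (ps : seq {poly K}) :
    evalAt t [seq c *: p | p <- ps] = [seq c * x | x <- evalAt t ps].
  by rewrite /evalAt -!map_comp; apply: eq_map => p /=; rewrite hornerZ.
have xs0 : [seq q ^ (2 * content Lam i) * z | i <- iota 1 l] = evalAt 0 xs.
  by rewrite ev tabPath0 -map_comp; apply: eq_map => i /=; rewrite mulrC.
have ys0 : [seq q ^ (2 * content Mu i) * w | i <- iota 1 m] = evalAt 0 ys.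
  by rewrite ev tabPath0 -map_comp; apply: eq_map => i /=; rewrite mulrC.
have sep : allrel separated (evalAt 0 xs) (evalAt 0 ys).
  by rewrite -xs0 -ys0; apply: content_separated.
pose f := heckeF q (l + m).
pose twX t := halfTwist (heckeF q l) 1 (rev (evalAt t (tabPath Lam))).
pose twY t := halfTwist (heckeF q m) 1 (rev (evalAt t (tabPath Mu))).
pose S t := crossProd f 1 (evalAt t (rev xs)) (evalAt t (rev ys)).
pose S' t := crossProd f 1 (evalAt t xs) (evalAt t ys).
pose lhs t := heckeShift (leq_addr m l : 0 + l <= l + m)%N (twX t) *
  heckeShift (leqnn (l + m)) (twY t) * S t.
pose rhs t := S' t * (heckeShift (leq_addl l m : 0 + m <= l + m)%N (twY t) *
  heckeShift (eq_leq (addnC m l)) (twX t)).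
(* For generic t the parameters are distinct, and both sides are half twists. *)
have rlE : generically (fun t => rhs t = lhs t).
  have sepxy : generically (fun t => forall x, x \in xs -> forall y, y \in ys ->
      separated x.[t] y.[t]).
    apply: generically_seq => x hx; apply: generically_seq => y hy.
    apply: separated_generically.
    by apply: (allrelP sep); apply: map_f.
  have := generically_and (pairwise_tabPath Lam) (pairwise_tabPath Mu).
  move/(generically_and sepxy); apply: generically_sub => t [sxy [pX pY]].
  have sz la' l' (L : stdTableau la' l') : size (rev (evalAt t (tabPath L))) = l'.
    by rewrite size_rev !size_map size_iota.
  have scale c k ps : c != 0 ->
      halfTwist f k (rev (evalAt t ps)) =
      halfTwist f k (rev (evalAt t [seq c *: p | p <- ps])).
    move=> c0; rewrite ev -[in RHS]map_rev halfTwist_map // => i x y.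
    exact: heckeF_scale.
  have psep c ps : c != 0 ->
      pairwise (fun a b => separated b a) (rev (evalAt t ps)) ->
      pairwise (fun a b => separated b a) (rev (evalAt t [seq c *: p | p <- ps])).
    move=> c0; rewrite ev -[X in _ -> pairwise _ X]map_rev pairwise_map.
    apply: sub_pairwise => x y /=.
    rewrite /separated !mulf_eq0 (negPf c0) /= => /and3P[-> -> xy].
    by apply: contra_neq xy; apply: mulfI.
  rewrite /rhs /lhs /twX /twY !heckeShift_halfTwist ?sz // -/f.
  rewrite !(scale z _ (tabPath Lam)) // !(scale w _ (tabPath Mu)) // -/xs -/ys.
  rewrite /S /S' /evalAt !map_rev -!/(evalAt _ _).
  have szX : size (rev (evalAt t xs)) = l by rewrite size_rev !size_map size_iota.
  have szY : size (rev (evalAt t ys)) = m by rewrite size_rev !size_map size_iota.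
  have := @halfTwist_crossProd _ _ f separated (l + m) _ _ 1
    (rev (evalAt t xs)) (rev (evalAt t ys)).
  rewrite szX szY !revK !add1n => -> //.
  - exact: heckeF_comm.
  - by move=> i x y u; apply: heckeF_YB.
  - by apply: psep.
  - by apply: psep.
  apply/allrelP => a b; rewrite !mem_rev => /mapP[x hx ->] /mapP[y hy ->].
  exact: sxy.
have evr t (ps : seq {poly K}) : rev (evalAt t ps) = evalAt t (rev ps).
  by rewrite /evalAt map_rev.
rewrite xs0 ys0 !evr; have regf := @regularAt0_heckeF K q (l + m).
(* The value of lhs at 0 is computed from its own factors, then from those of
   rhs, with which it agrees generically. *)
apply: (regularAt0_unique q_inj (f := lhs)).
  apply: regularAt0M; last first.
    apply: (regularAt0_crossProd regf).
    apply/allrelP => _ _ /mapP[x hx ->] /mapP[y hy ->].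
    by apply: (allrelP sep); apply: map_f; rewrite -mem_rev.
  by apply: regularAt0M; apply: regularAt0_map.
apply: regularAt0_generic rlE _; apply: regularAt0M.
  exact: (regularAt0_crossProd regf).
by apply: regularAt0M; apply: regularAt0_map.
Qed.
End Fusion.

(** * Induction over algebras given by generators and relations *)

Section GeneratedInduction.
Variables (K : fieldType) (G : choiceType).

Lemma freeAlg_ind (P : freeAlg K G -> Prop) :
  (forall c, P (c *: 1)) -> (forall x y, P x -> P y -> P (x + y)) ->
  (forall g x, P x -> P (freeGen K g * x)) -> forall x, P x.
Proof.
move=> P1 PD PM x; rewrite [x]monalg.monalgE.
have Pw (m : monalg.fmonom G) (c : K) : P (monalg.mkmalgU m c).
  case: m; elim=> [|g s IH].
    have <- : (c *: 1 : freeAlg K G) = monalg.mkmalgU (monalg.FMonom [::]) c.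
      rewrite -[RHS]mul1r monalg.malgM_def monalg.malgZ_def.
      rewrite -monalg.fmoneE monalg.fgmulgU.
      by apply: eq_bigr => k _; rewrite monalg.mulm1 mulrC.
    exact: P1.
  have -> : monalg.mkmalgU (monalg.FMonom (g :: s)) c =
      freeGen K g * monalg.mkmalgU (monalg.FMonom s) c.
    rewrite /freeGen monalg.malgM_def monalg.fgmulUU mul1r; congr monalg.mkmalgU.
    by rewrite [RHS]monalg.fmmulE monalg.fmuE.
  exact: PM.
by apply: big_ind => [|y y' |m _]; [rewrite -(scale0r 1)|apply: PD|apply: Pw].
Qed.

Variable rel : freeAlg K G -> freeAlg K G -> Prop.

Lemma presAlg_ind (P : presAlg rel -> Prop) :
  (forall c, P (c *: (1 : presAlg rel))) -> (forall x y, P x -> P y -> P (x + y)) ->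
  (forall g x, P x -> P (presGen rel g * x)) -> forall x, P x.
Proof.
move=> P1 PD PM x; have [y ->] := presPi_surj x.
elim/freeAlg_ind: y => [c|y y' Py Py'|g y Py].
- by rewrite presPiZ; apply: P1.
- by rewrite presPiD; apply: PD.
- by rewrite presPiM; apply: PM.
Qed.
End GeneratedInduction.

(** * Intertwiners of the affine Hecke algebra *)

Section AffineRelations.
Variables (K : fieldType) (q : K) (n : nat) (q0 : q != 0).
Local Notation AH := (affHecke n q0).
Local Notation T := (affT n q0).
Local Notation Y := (affY n q0).

Lemma affY_map i : (0 < i <= n)%N -> Y i = presPi _ (affFreeY K n i).
Proof. by move=> hi; rewrite /affY /affFreeY !genAtE. Qed.

Lemma affT_sqr i : (0 < i < n)%N -> T i * T i = (q - q^-1) *: T i + 1.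
Proof. by move=> hi; apply: quad_sqr q0 _; apply: affHecke_heckeP; apply: HeckeQuad. Qed.

Lemma affTYT i : (0 < i < n)%N -> T i * Y i * T i = Y i.+1.
Proof.
move=> hi; rewrite (affT_map q0 hi) !affY_map; try by lia.
have h : affHeckePres q (affFreeT K n i * affFreeY K n i * affFreeT K n i)
  (affFreeY K n i.+1) by apply: AffTYT.
by apply: etrans _ (presPi_rel h); apply: esym; apply: presPiM3.
Qed.

Lemma affTY_comm i j : (0 < i < n)%N -> (0 < j <= n)%N -> j != i -> j != i.+1 ->
  T i * Y j = Y j * T i.
Proof.
move=> hi hj ji ji1; rewrite (affT_map q0 hi) !affY_map //.
have h : affHeckePres q (affFreeT K n i * affFreeY K n j)
  (affFreeY K n j * affFreeT K n i) by apply: AffTY.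
apply: etrans (esym (presPiM _ _ _)) _; apply: etrans (presPi_rel h) _.
exact: presPiM.
Qed.
End AffineRelations.

Section AffineModules.
Variables (K : fieldType) (q : K) (n : nat) (q0 : q != 0).
Local Notation AH := (affHecke n q0).
Local Notation T := (affT n q0).
Local Notation Y := (affY n q0).
Local Notation s := (q - q^-1).

(** This relation and the next let the Y pass the T without inverses: they come
    from T_i Y_i T_i = Y_(i+1) and the quadratic relation. *)
Lemma affYT_succ i : (0 < i < n)%N ->
  Y i.+1 * T i = T i * Y i + s%:A * Y i.+1.
Proof.
move=> hi; rewrite -affTYT // -[LHS]mulrA affT_sqr // mulrDr mulr1 addrC.
by rewrite mulr_algl -scalerAr.
Qed.

Lemma affYT i : (0 < i < n)%N ->
  Y i * T i = T i * Y i.+1 - s%:A * Y i.+1.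
Proof.
move=> hi; rewrite -affTYT // !mulrA affT_sqr // mulr_algl -!scalerAl.
by rewrite !mulrDl mul1r -!scalerAl [RHS]addrAC subrr add0r.
Qed.

Variable W : lmodType AH.

Definition weights (ys : seq K) (u : W) :=
  forall i, (i < size ys)%N -> Y i.+1 *: u = (nth 0 ys i)%:A *: u.

Lemma affIncl_heckeF i x y : (0 < i < n)%N ->
  affIncl q0 (heckeF q n i x y) = T i + (s / (x^-1 * y - 1))%:A.
Proof. by move=> hi; rewrite rmorphD /= affInclT // linearZ /= rmorph1. Qed.

(** The coefficient c = (q - q^-1) / (x^-1 y - 1) of F_i(x, y) is the solution of
    c (y - x) = (q - q^-1) x, which is what the relations between T_i, Y_i and
    Y_(i+1) require for T_i + c to exchange the two eigenvalues. *)
Lemma weights_heckeF ys1 x y ys2 u : ((size ys1).+1 < n)%N -> separated x y ->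
  (size ys1 + (size ys2).+2 <= n)%N ->
  weights (ys1 ++ y :: x :: ys2) u ->
  weights (ys1 ++ x :: y :: ys2)
    (affIncl q0 (heckeF q n (size ys1).+1 x y) *: u).
Proof.
move=> hn /and3P[x0 y0 xy] szn wu; set k := (size ys1).+1.
have hk : (0 < k < n)%N by [].
rewrite affIncl_heckeF //; set c := _ / _.
have cE : c * (y - x) = s * x.
  rewrite /c (_ : x^-1 * y - 1 = (y - x) / x); last by field.
  rewrite invf_div mulrA -mulrA mulVf ?mulr1 //.
  by rewrite subr_eq0 eq_sym.
have nthk : nth 0 (ys1 ++ y :: x :: ys2) (size ys1) = y by rewrite nth_cat ltnn subnn.
have nthk1 : nth 0 (ys1 ++ y :: x :: ys2) k = x.
  by rewrite nth_cat /k ltnNge leqnSn /= subSnn.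
have szE : size (ys1 ++ y :: x :: ys2) = (size ys1 + (size ys2).+2)%N.
  by rewrite size_cat.
have Yk : Y k *: u = y%:A *: u by rewrite -nthk wu // szE; lia.
have Yk1 : Y k.+1 *: u = x%:A *: u by rewrite -nthk1 wu // szE /k; lia.
have yc : y * c = x * c + s * x by rewrite -cE; ring.
have cC a (b : AH) : b * a%:A = a%:A * b by exact: comm_scalar.
have F_comm j a : (0 < j <= n)%N -> j != k -> j != k.+1 -> Y j *: u = a%:A *: u ->
    Y j *: ((T k + c%:A) *: u) = a%:A *: ((T k + c%:A) *: u).
  move=> hj jk jk1 Yj.
  by rewrite !scalerA mulrDr -affTY_comm // cC -mulrDl -scalerA Yj scalerA -cC.
have scalM a b : a%:A * b%:A = (a * b)%:A :> AH by rewrite mulr_algl scalerA.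
have F_k : Y k *: ((T k + c%:A) *: u) = x%:A *: ((T k + c%:A) *: u).
  have -> : Y k *: ((T k + c%:A) *: u) =
      (T k * x%:A - s%:A * x%:A + c%:A * y%:A) *: u.
    rewrite scalerA mulrDr affYT // (cC c (Y k)) !scalerDl !scaleNr.
    by rewrite -!scalerA Yk Yk1.
  rewrite scalerA; congr (_ *: u); rewrite mulrDr !scalM cC -addrA; congr (_ + _).
  by rewrite -scaleNr -scalerDl (mulrC c) yc addrC (mulrC s) addrK.
have F_k1 : Y k.+1 *: ((T k + c%:A) *: u) = y%:A *: ((T k + c%:A) *: u).
  have -> : Y k.+1 *: ((T k + c%:A) *: u) =
      (T k * y%:A + s%:A * x%:A + c%:A * x%:A) *: u.
    rewrite scalerA mulrDr affYT_succ // (cC c (Y k.+1)) !scalerDl.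
    by rewrite -!scalerA Yk Yk1.
  rewrite scalerA; congr (_ *: u); rewrite mulrDr !scalM cC -addrA; congr (_ + _).
  by rewrite -scalerDl yc addrC (mulrC c).
move=> i; rewrite size_cat /= => hi.
have [->|ik] := eqVneq i (size ys1); first by rewrite nth_cat ltnn subnn.
have [->|ik1] := eqVneq i k.
  by rewrite nth_cat /k ltnNge leqnSn /= subSnn.
have -> : nth 0 (ys1 ++ x :: y :: ys2) i = nth 0 (ys1 ++ y :: x :: ys2) i.
  rewrite !nth_cat; case: ltnP => // hi'.
  have -> : (i - size ys1 = (i - size ys1 - 2).+2)%N.
    rewrite -addn2 subnK // leq_subRL // addn2 ltn_neqAle eq_sym ik1.
    by rewrite ltn_neqAle eq_sym ik.
  by [].
by apply: F_comm; rewrite ?wu ?szE // /k in ik1 *; lia.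
Qed.

Lemma weights_rowProd ys1 x ys ys2 u :
  (size ys1 + size ys + (size ys2).+1 <= n)%N -> all (separated x) ys ->
  weights (ys1 ++ ys ++ x :: ys2) u ->
  weights (ys1 ++ x :: ys ++ ys2)
    (affIncl q0 (rowProd (heckeF q n) (size ys1).+1 x ys) *: u).
Proof.
elim: ys ys1 => [|y ys IH] ys1 /= szn.
  by move=> _; rewrite rmorph1 scale1r.
case/andP=> xy xys wu; rewrite rmorphM -scalerA.
apply: weights_heckeF => //; rewrite ?size_cat; try lia.
rewrite -cat_rcons -(size_rcons ys1 y); apply: IH => //.
  by rewrite size_rcons; lia.
by rewrite cat_rcons.
Qed.

Lemma weights_crossProd ys1 xs ys ys2 u :
  (size ys1 + size xs + size ys + size ys2 <= n)%N -> allrel separated xs ys ->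
  weights (ys1 ++ ys ++ xs ++ ys2) u ->
  weights (ys1 ++ xs ++ ys ++ ys2)
    (affIncl q0 (crossProd (heckeF q n) (size ys1).+1 xs ys) *: u).
Proof.
elim: xs ys1 u => [|x xs IH] ys1 u /= szn.
  by move=> _; rewrite rmorph1 scale1r.
case/andP=> xys xsys wu; rewrite rmorphM -scalerA.
rewrite -cat_rcons -(size_rcons ys1 x); apply: IH => //.
  by rewrite size_rcons; lia.
by rewrite cat_rcons size_rcons; apply: weights_rowProd; rewrite ?size_cat //; lia.
Qed.
End AffineModules.

Section HeckeInduction.
Variables (K : fieldType) (q : K) (n : nat).

Lemma hecke_ind (P : hecke q n -> Prop) :
  (forall c, P c%:A) -> (forall x y, P x -> P y -> P (x + y)) ->
  (forall i x, (0 < i < n)%N -> P x -> P (heckeT q n i * x)) -> forall x, P x.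
Proof.
move=> P1 PD PT; apply: presAlg_ind => // -[i hi] x Px.
have := PT i x hi Px; by rewrite /heckeT genAtE.
Qed.

Variable q0 : q != 0.
(** The inverse of Y_i enters through the equations that characterize it. *)
Lemma affHecke_ind (P : affHecke n q0 -> Prop) :
  (forall c, P c%:A) -> (forall x y, P x -> P y -> P (x + y)) ->
  (forall i x, (0 < i < n)%N -> P x -> P (affT n q0 i * x)) ->
  (forall i x, (0 < i <= n)%N -> P x -> P (affY n q0 i * x)) ->
  (forall i b x, (0 < i <= n)%N -> affY n q0 i * b = 1 -> b * affY n q0 i = 1 ->
    P x -> P (b * x)) ->
  forall x, P x.
Proof.
move=> P1 PD PT PY PV; apply: presAlg_ind => // -[[i hi]|[[i hi]|[i hi]]] x Px.
- have := PT i x hi Px; by rewrite /affT genAtE.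
- have := PY i x hi Px; by rewrite /affY genAtE.
- apply: (PV i) => //.
    have h : affHeckePres q (affFreeY K n i * affFreeV K n i) 1 by apply: AffYV.
    rewrite affY_map // /presGen -(genAtE (fun g => @freeGen K (affIdx n) (inr (inr g)))).
    by apply: etrans (esym (presPiM _ _ _)) _; apply: presPi_rel h.
  have h : affHeckePres q (affFreeV K n i * affFreeY K n i) 1 by apply: AffVY.
  rewrite affY_map // /presGen -(genAtE (fun g => @freeGen K (affIdx n) (inr (inr g)))).
  by apply: etrans (esym (presPiM _ _ _)) _; apply: presPi_rel h.
Qed.
End HeckeInduction.

Lemma affIncl_scalar (K : fieldType) (q : K) n (q0 : q != 0) (c : K) :
  affIncl q0 (c%:A : hecke q n) = c%:A.
Proof. by rewrite linearZ /= rmorph1. Qed.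

Section Intertwining.
Variables (K : fieldType) (q : K) (n : nat) (q0 : q != 0).
Local Notation AH := (affHecke n q0).
Local Notation T := (affT n q0).
Local Notation Y := (affY n q0).
Local Notation s := (q - q^-1).
Variables (W W' : lmodType AH) (I : W -> W').
Hypothesis I_add : {morph I : u u' / u + u'}.
Hypothesis I_hecke : forall h u, I (affIncl q0 h *: u) = affIncl q0 h *: I u.

Let I_T i u : (0 < i < n)%N -> I (T i *: u) = T i *: I u.
Proof. by move=> hi; rewrite -!(affInclT q0 hi) I_hecke. Qed.

Let I_scal (c : K) u : I ((c%:A : AH) *: u) = (c%:A : AH) *: I u.
Proof.
rewrite -affIncl_scalar.
exact: I_hecke.
Qed.

Definition commY u := forall i, (0 < i <= n)%N -> I (Y i *: u) = Y i *: I u.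

(** Y_i T_j is a combination of the Y and of the T_j Y with scalar coefficients,
    and [I] commutes with T_j and the scalars. *)
Lemma commY_T j u : (0 < j < n)%N -> commY u -> commY (T j *: u).
Proof.
move=> hj cu i hi; rewrite I_T // !scalerA.
have [->|ij] := eqVneq i j.
  rewrite affYT // -mulNr -scaleNr !scalerDl -!scalerA I_add I_T // I_scal !cu //; lia.
have [->|ij1] := eqVneq i j.+1.
  rewrite affYT_succ // (scalerDl u) (scalerDl (I u)) -!scalerA I_add I_T // I_scal.
  by rewrite !cu //; lia.
by rewrite -affTY_comm // -!scalerA I_T // cu.
Qed.

Lemma commY_hecke h u : commY u -> commY (affIncl q0 h *: u).
Proof.
move=> cu; elim/hecke_ind: h => [c|x y cx cy|j x hj cx].
- move=> i hi; have cC : Y i * affIncl q0 c%:A = affIncl q0 c%:A * Y i.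
    by rewrite affIncl_scalar; apply: comm_scalar.
  by rewrite I_hecke !scalerA cC -!scalerA I_hecke cu.
- move=> i hi; rewrite rmorphD scalerDl !(I_add, scalerDr).
  by rewrite cx ?cy //.
- by rewrite rmorphM -scalerA /= affInclT //; apply: commY_T.
Qed.

(** By [commY_T] the vectors on which [I] commutes with all the Y form a
    submodule over the finite Hecke algebra; containing [v], it is everything.
    The remaining generators are inverses of the Y. *)
Lemma intertwines_generated (v : W) :
  (forall u, exists h, u = affIncl q0 h *: v) -> commY v ->
  forall a u, I (a *: u) = a *: I u.
Proof.
move=> gen cv a; have cY u : commY u.
  by have [h ->] := gen u; apply: commY_hecke.
elim/affHecke_ind: a => [c|x y cx cy|i x hi cx|i x hi cx|i b x hi Yb bY cx] u.
- exact: I_scal.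
- by rewrite !scalerDl I_add cx cy.
- by rewrite -!scalerA I_T // cx.
- by rewrite -!scalerA cY // cx.
- rewrite -!scalerA -cx -[LHS]scale1r -bY -[LHS]scalerA -cY // (scalerA (Y i)) Yb.
  by rewrite scale1r.
Qed.
End Intertwining.

(** * Right multiplication between realized modules *)

Lemma realized_gen (K : fieldType) (q : K) n (q0 : q != 0)
    (W : lmodType (affHecke n q0)) (v : hecke q n) (y : nat -> K)
    (iota : W -> hecke q n) :
  realizedBy v y iota ->
  exists2 u0, iota u0 = v & forall u, exists h, u = affIncl q0 h *: u0.
Proof.
move=> realW; have : range iota v.
  by rewrite (real_range realW); exists 1; rewrite mul1r.
case=> u0 _ u0v; exists u0 => // u.
have : range iota (iota u) by exists u.
rewrite (real_range realW) => -[h hE]; exists h.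
by apply: (real_inj realW); rewrite (real_T realW) u0v.
Qed.

Section RealizedModules.
Variables (K : fieldType) (q : K) (n : nat) (q0 : q != 0).
Variables (W W' : lmodType (affHecke n q0)) (v v' : hecke q n) (y y' : nat -> K).
Variables (iota : W -> hecke q n) (iota' : W' -> hecke q n).
Hypotheses (realW : realizedBy v y iota) (realW' : realizedBy v' y' iota').

(** The first hypothesis makes right multiplication by [S] map the left ideal of
    [v] to that of [v'], with [v] sent to [S' * v']; the second one says that the
    image of [v] has the eigenvalues of [v]. *)
Lemma intertwiner_of_rightMul (S S' : hecke q n) :
  v * S = S' * v' ->
  (forall i u', (0 < i <= n)%N -> iota' u' = v' ->
    affY n q0 i *: (affIncl q0 S' *: u') = (y i)%:A *: (affIncl q0 S' *: u')) ->
  exists I : {linear W -> W'}, forall u, iota' (I u) = iota u * S.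
Proof.
move=> vS YS'.
have img u : exists u', iota' u' = iota u * S.
  have : range iota (iota u) by exists u.
  rewrite (real_range realW) => -[h ->]; rewrite -mulrA vS mulrA.
  have : range iota' (h * S' * v') by rewrite (real_range realW'); exists (h * S').
  by case=> u' _ <-; exists u'.
have [I IE] := choice img.
have I_add : {morph I : a b / a + b}.
  move=> a b; apply: (real_inj realW').
  by rewrite (real_add realW') !IE (real_add realW) mulrDl.
have I_hecke h u : I (affIncl q0 h *: u) = affIncl q0 h *: I u.
  by apply: (real_inj realW'); rewrite (real_T realW') !IE (real_T realW) mulrA.
have [u0 u0v gen] := realized_gen realW.
have I_lin : forall a u, I (a *: u) = a *: I u.
  apply: (intertwines_generated I_add I_hecke gen) => i hi.
  rewrite (real_Y realW) // -affIncl_scalar I_hecke affIncl_scalar.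
  have [w' w'v' _] := realized_gen realW'.
  have -> : I u0 = affIncl q0 S' *: w'.
    by apply: (real_inj realW'); rewrite IE u0v vS (real_T realW') w'v'.
  by rewrite YS'.
have lin : linear I by move=> a u u'; rewrite I_add I_lin.
pose J := GRing.isLinear.Build _ _ _ _ I lin.
pose I' : {linear W -> W'} := HB.pack I J.
by exists I'.
Qed.
End RealizedModules.

Lemma qpar_exp_inj (R : realType) : injective (fun i => qpar R ^+ i).
Proof.
move=> i j /=; rewrite /qpar -!rmorphXn /= => /eqP.
rewrite tofrac_eq => /eqP/(congr1 (fun p : {poly _} => size p)).
by rewrite !size_polyXn => -[].
Qed.

Theorem proposition4p2 (R : realType) (l m : nat) (la mu : seq nat)
    (Lam : stdTableau la l) (Mu : stdTableau mu m) (z w : Cq R)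
    (W W' : lmodType (affHecke (l + m) (qpar_neq0 R)))
    (iotaW : W -> hecke (qpar R) (l + m))
    (iotaW' : W' -> hecke (qpar R) (l + m)) :
  (0 < l)%N -> (0 < m)%N -> isPartition la l -> isPartition mu m ->
  z != 0 -> w != 0 -> (forall k : int, z^-1 * w != qpar R ^ (2 * k)) ->
  realizedBy (genW (qpar R) Lam Mu) (eigW (qpar R) Lam Mu z w) iotaW ->
  realizedBy (genW' (qpar R) Lam Mu) (eigW' (qpar R) Lam Mu z w) iotaW' ->
  exists I : {linear W -> W'},
    forall u : W, iotaW' (I u) = iotaW u * elemS (qpar R) Lam Mu z w.
Proof.
move=> _ _ _ _ z0 w0 zw realW realW'; set q := qpar R in realW realW' *.
have q0 : q != 0 := qpar_neq0 R.
apply: (intertwiner_of_rightMul realW realW'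
  (fusion_crossProd q0 (@qpar_exp_inj R) Lam Mu z0 w0 zw)).
set xs := map _ (iota 1 l); set ys := map _ (iota 1 m).
have szx : size xs = l by rewrite size_map size_iota.
have szy : size ys = m by rewrite size_map size_iota.
move=> i u' hi u'v'.
have nthx j : (j < l)%N -> nth 0 xs j = z * q ^ (2 * content Lam j.+1).
  by move=> hj; rewrite (nth_map 0%N) ?size_iota // nth_iota // mulrC add1n.
have nthy j : (j < m)%N -> nth 0 ys j = w * q ^ (2 * content Mu j.+1).
  by move=> hj; rewrite (nth_map 0%N) ?size_iota // nth_iota // mulrC add1n.
have sep : allrel separated xs ys by exact: (content_separated q0 _ _ _ _ z0 w0 zw).
have wu : weights ([::] ++ ys ++ xs ++ [::]) u'.
  move=> j; rewrite cats0 cat0s size_cat szx szy => hj.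
  rewrite (real_Y realW') //; last by lia.
  congr (_%:A *: _); rewrite /eigW' nth_cat szy.
  case: ltnP => hjm; first by rewrite nthy.
  by rewrite nthx ?subSn //; lia.
have := weights_crossProd _ sep wu.
rewrite cats0 cat0s szx szy addn0 => /(_ (leqnn _)).
case: i hi => // i hi /(_ i); rewrite size_cat szx szy => /(_ hi) ->.
congr (_%:A *: _); rewrite /eigW nth_cat szx.
case: ltnP => hil; first by rewrite nthx.
by rewrite nthy ?subSn //; lia.
Qed.
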